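(* Let $(A,\phi_0)$ be a Jacobi algebroid over a manifold $M$, with anchor $\rho$, and let $P_1,P_2\in\Gamma(\wedge^2A)$ be compatible Jacobi bivectors on $(A,\phi_0)$, i.e. $[P_1,P_1]^{\phi_0}=[P_2,P_2]^{\phi_0}=[P_1,P_2]^{\phi_0}=0$. For $i=1,2$ let $P_M^i=\rho^2P_i$ and $E_M^i=\rho(P_i^\sharp(\phi_0))$ be the Jacobi structure on $M$ induced by $P_i$. Then $(P_M^1,E_M^1)$ and $(P_M^2,E_M^2)$ are compatible Jacobi structures on $M$.
   Context: A Jacobi algebroid $(A,\phi_0)$ is a Lie algebroid $(A,[\cdot,\cdot],\rho)$ over $M$ with a 1-form $\phi_0\in\Gamma(A^* )$ that is closed for the Lie algebroid differential $\mathrm d$ (a 1-cocycle). The Schouten bracket on $\Gamma(\wedge^\bullet A)$ is the extension of the Lie bracket with $[X,f]=\rho(X)f$, $[P,Q]=-(-1)^{(p-1)(q-1)}[Q,P]$, $[P,Q\wedge R]=[P,Q]\wedge R+(-1)^{(p-1)q}Q\wedge[P,R]$, for $P,Q,R$ of degrees $p,q,r$. The Schouten-Jacobi bracket is $[P,Q]^{\phi_0}=[P,Q]+(p-1)P\wedge i_{\phi_0}Q-(-1)^{p-1}(q-1)\,i_{\phi_0}P\wedge Q$ for $P\in\Gamma(\wedge^pA)$, $Q\in\Gamma(\wedge^qA)$. For a bivector $P$, $P^\sharp:A^*\to A$ is defined by $\langle\beta,P^\sharp\alpha\rangle=P(\alpha,\beta)$, so $i_{\phi_0}P=P^\sharp(\phi_0)$.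 A Jacobi bivector is $P\in\Gamma(\wedge^2A)$ with $[P,P]^{\phi_0}=0$. The map $\rho^2:\Gamma(\wedge^2A)\to\Gamma(\wedge^2TM)$ is $\rho^2P(\alpha,\beta)=P(\rho^*\alpha,\rho^*\beta)$. A Jacobi structure on $M$ is a pair $(\Lambda,E)$ of a bivector field and a vector field with $[\Lambda,\Lambda]=-2E\wedge\Lambda$ and $[E,\Lambda]=0$ (same Schouten sign convention). Two Jacobi structures $(\Lambda_1,E_1)$, $(\Lambda_2,E_2)$ are compatible if $(\Lambda_1+\Lambda_2,E_1+E_2)$ is a Jacobi structure; equivalently $[\Lambda_1,\Lambda_2]=-E_1\wedge\Lambda_2-E_2\wedge\Lambda_1$ and $[E_1,\Lambda_2]+[E_2,\Lambda_1]=0$. It is known that if $P$ is a Jacobi bivector on $(A,\phi_0)$ then $(\rho^2P,\rho(P^\sharp\phi_0))$ is a Jacobi structure on $M$. *)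

(* Defs.v *)
From HB Require Import structures.
From mathcomp Require Import all_boot all_order all_algebra.
From mathcomp Require Import all_classical all_reals topology normedtype derive.
From mathcomp Require Import ring.
Set Implicit Arguments.
Unset Strict Implicit.
Unset Printing Implicit Defensive.
Import Order.TTheory GRing.Theory Num.Theory numFieldNormedType.Exports.
Local Open Scope classical_set_scope.
Local Open Scope ring_scope.

Section SmoothRn.
Context {R : realType} {n : nat}.
Implicit Types (F G : 'rV[R]_n -> R) (V : set 'rV[R]_n) (s : seq 'I_n).

Definition partials s F : 'rV[R]_n -> R :=
  foldr (fun i G u => 'D_(delta_mx 0 i) G u) F s.

(* C^oo on V, which is open wherever this is used: all iterated partial       *)
(* derivatives exist and are continuous at the points of V.                   *)
Definition smooth_Rn V F := forall s u, V u ->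
  {for u, continuous (partials s F)} /\
  (forall i, derivable (partials s F) u (delta_mx 0 i)).

Let good V F := forall u, V u -> {for u, continuous F} /\
  (forall i, derivable F u (delta_mx 0 i)).

Let d i F : 'rV[R]_n -> R := fun u => 'D_(delta_mx 0 i) F u.

Let ck V N F := forall s, (size s <= N)%N -> good V (partials s F).

Let smoothP V F : smooth_Rn V F <-> forall N, ck V N F.
Proof. by split=> [sF N s _|sF s]; [exact: sF|exact: (sF (size s) s)]. Qed.

Let ckS V N F : ck V N.+1 F <-> good V F /\ forall i, ck V N (d i F).
Proof.
split=> [cF|[gF dF] s].
  split; first exact: (cF [::]).
  move=> i s sN; have := cF (rcons s i); rewrite size_rcons => /(_ sN).
  by rewrite /partials -cats1 foldr_cat.
case/lastP: s => [//|s i]; rewrite size_rcons ltnS => sN.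
by rewrite /partials -cats1 foldr_cat; exact: dF.
Qed.

Let eq_near V F G u : open V -> V u -> {in V, F =1 G} ->
  \forall v \near u, F v = G v.
Proof.
by move=> oV Vu FG; near=> v; apply: FG; rewrite inE; near: v;
   exact: open_nbhs_nbhs.
Unshelve. all: by end_near. Qed.

Let good_ext V F G : open V -> {in V, F =1 G} -> good V F -> good V G.
Proof.
move=> oV FG gF u Vu; have [cF dF] := gF u Vu.
have E := eq_near oV Vu FG; split=> [|i]; last exact: near_eq_derivable (dF i).
rewrite /prop_for /continuous_at -FG ?inE //.
exact: (cvg_trans (near_eq_cvg (F := nbhs u) E) cF).
Qed.

Let ck_ext V N F G : open V -> {in V, F =1 G} -> ck V N F -> ck V N G.
Proof.
move=> oV; elim: N F G => [|N IH] F G FG.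
  by move=> cF [] // _; exact: good_ext FG (cF [::] isT).
move=> /ckS[gF cF]; apply/ckS; split; first exact: good_ext FG gF.
move=> i; apply: IH (cF i) => u; rewrite inE => Vu.
by apply: near_eq_derive; exact: eq_near FG.
Qed.

Let goodD V F G : good V F -> good V G -> good V (F \+ G).
Proof.
move=> gF gG u Vu; have [cF dF] := gF u Vu; have [cG dG] := gG u Vu.
by split=> [|i]; [exact: cvgD cF cG|exact: derivableD (dF i) (dG i)].
Qed.

Let goodM V F G : good V F -> good V G -> good V (F \* G).
Proof.
move=> gF gG u Vu; have [cF dF] := gF u Vu; have [cG dG] := gG u Vu.
by split=> [|i]; [exact: cvgM cF cG|exact: derivableM (dF i) (dG i)].
Qed.

Let ckD V N F G : open V -> ck V N F -> ck V N G -> ck V N (F \+ G).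
Proof.
move=> oV; elim: N F G => [|N IH] F G.
  by move=> cF cG [] // _; exact: goodD (cF [::] isT) (cG [::] isT).
move=> /ckS[gF cF] /ckS[gG cG]; apply/ckS; split; first exact: goodD.
move=> i; apply: ck_ext (IH _ _ (cF i) (cG i)) => // u; rewrite inE => Vu.
by rewrite /d deriveD //; [exact: (gF u Vu).2|exact: (gG u Vu).2].
Qed.

Let ckW V N F : ck V N.+1 F -> ck V N F.
Proof. by move=> cF s sN; apply: cF; exact: leqW. Qed.

Let ckM V N F G : open V -> ck V N F -> ck V N G -> ck V N (F \* G).
Proof.
move=> oV; elim: N F G => [|N IH] F G.
  by move=> cF cG [] // _; exact: goodM (cF [::] isT) (cG [::] isT).
move=> cF' cG'; have /ckS[gF cF] := cF'; have /ckS[gG cG] := cG'.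
apply/ckS; split; first exact: goodM.
move=> i; have H := ckD oV (IH _ _ (ckW cF') (cG i)) (IH _ _ (ckW cG') (cF i)).
apply: ck_ext H => // u; rewrite inE => Vu.
by rewrite /d deriveM //; [exact: (gF u Vu).2|exact: (gG u Vu).2].
Qed.

Lemma smooth_Rn_ext V F G : open V -> {in V, F =1 G} ->
  smooth_Rn V F -> smooth_Rn V G.
Proof. by move=> oV FG /smoothP sF; apply/smoothP => N; exact: ck_ext FG _. Qed.

Lemma smooth_RnD V F G : open V -> smooth_Rn V F -> smooth_Rn V G ->
  smooth_Rn V (F \+ G).
Proof.
by move=> oV /smoothP sF /smoothP sG; apply/smoothP => N; exact: ckD.
Qed.

Lemma smooth_RnM V F G : open V -> smooth_Rn V F -> smooth_Rn V G ->
  smooth_Rn V (F \* G).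
Proof.
by move=> oV /smoothP sF /smoothP sG; apply/smoothP => N; exact: ckM.
Qed.

Lemma smooth_Rn_cst V (c : R) : smooth_Rn V (cst c).
Proof.
move=> s u _; have -> : partials s (cst c) = cst (if s is [::] then c else 0).
  elim: s => [//|i s IH]; apply/funext => v.
  by rewrite /= -/(partials s _) IH derive_cst.
by split=> [|i]; [exact: cst_continuous|exact: derivable_cst].
Qed.

End SmoothRn.

Record chart (R : realType) (n : nat) (M : topologicalType) := Chart {
  cdom : set M;
  cmap : M -> 'rV[R]_n;
  cinv : 'rV[R]_n -> M;
  cdom_open : open cdom;
  cran_open : open (cmap @` cdom);
  cmapK : forall x, cdom x -> cinv (cmap x) = x;
  cmap_cont : forall x, cdom x -> {for x, continuous cmap};
  cinv_cont : forall x, cdom x -> {for cmap x, continuous cinv} }.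

Record manifold (R : realType) (n : nat) := Manifold {
  msort :> topologicalType;
  mhausdorff : hausdorff_space msort;
  msecond_countable : @second_countable msort;
  atlas : set (chart R n msort);
  atlas_cover : forall x, exists2 c, atlas c & cdom c x;
  atlas_smooth : forall c c', atlas c -> atlas c' -> forall k,
    smooth_Rn (cmap c @` (cdom c `&` cdom c'))
              (fun u => cmap c' (cinv c u) 0 k) }.

Section SmoothFunctions.
Context {R : realType} {n : nat} {M : manifold R n}.
Implicit Types (U : set M) (f g : M -> R).

Definition smooth_on U f := forall c, atlas c ->
  smooth_Rn (cmap c @` (U `&` cdom c)) (f \o cinv c).

Lemma chart_open U (c : chart R n M) :
  open U -> open (cmap c @` (U `&` cdom c)).
Proof.
move=> oU; rewrite openE => _ [x [Ux cx] <-].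
have Nr : nbhs (cmap c x) (cmap c @` cdom c).
  by apply: open_nbhs_nbhs; split; [exact: cran_open|exists x].
have NU : nbhs (cmap c x) (cinv c @^-1` U).
  apply: (cinv_cont cx); rewrite cmapK //.
  exact: open_nbhs_nbhs.
rewrite /interior; apply: filterS (filterI Nr NU) => _ [[y cy <-]].
by rewrite /preimage /= cmapK // => Uy; exists y.
Qed.

Lemma smooth_onD U f g : open U -> smooth_on U f -> smooth_on U g ->
  smooth_on U (f + g).
Proof.
move=> oU sf sg c ac.
exact: (smooth_RnD (chart_open oU) (sf c ac) (sg c ac)).
Qed.

Lemma smooth_onM U f g : open U -> smooth_on U f -> smooth_on U g ->
  smooth_on U (f * g).
Proof.
move=> oU sf sg c ac.
exact: (smooth_RnM (chart_open oU) (sf c ac) (sg c ac)).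
Qed.

Lemma smooth_on_cst U (k : R) : smooth_on U (cst k).
Proof. by move=> c _; exact: smooth_Rn_cst. Qed.

End SmoothFunctions.

Section Cinf.
Context {R : realType} {n : nat} (M : manifold R n).

Definition is_smooth : {pred M -> R} := fun f => `[< smooth_on setT f >].

Record Cinf := MkCinf { Cinf_fun :> M -> R; _ : Cinf_fun \in is_smooth }.

HB.instance Definition _ := [isSub for Cinf_fun].
HB.instance Definition _ := [Choice of Cinf by <:].

Let is_smoothE f : (f \in is_smooth) = `[< smooth_on setT f >]. Proof. by []. Qed.

Let is_smooth_subring : subring_closed is_smooth.
Proof.
split=> [|f g|f g]; rewrite !is_smoothE.
- by apply/asboolP; exact: smooth_on_cst.
- move=> /asboolP sf /asboolP sg; apply/asboolP.
  have sN := @smooth_onM R n M setT _ g openT (@smooth_on_cst R n M setT (- 1)) sg.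
  have := @smooth_onD R n M setT f _ openT sf sN.
  rewrite (_ : cst (- 1) * g = - g) //.
  by apply/funext => x; exact: mulN1r.
- move=> /asboolP sf /asboolP sg; apply/asboolP.
  exact: (@smooth_onM R n M setT f g openT sf sg).
Qed.

HB.instance Definition _ :=
  GRing.isSubringClosed.Build (M -> R) is_smooth is_smooth_subring.

Let is_smooth_scale : GRing.scaler_closed is_smooth.
Proof.
move=> a f; rewrite !is_smoothE => /asboolP sf; apply/asboolP.
have H := @smooth_onM R n M setT (cst a) f openT (@smooth_on_cst R n M _ a) sf.
have E : a *: f = cst a * f by apply/funext.
by rewrite E.
Qed.

HB.instance Definition _ :=
  GRing.isScaleClosed.Build R (M -> R) is_smooth is_smooth_scale.
HB.instance Definition _ := GRing.SubChoice_isSubComPzRing.Build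
  (M -> R) is_smooth Cinf is_smooth_subring.
HB.instance Definition _ := [SubZmodule_isSubLmodule of Cinf by <:].

End Cinf.

(* g itself when g : M -> R is smooth, and 0 otherwise *)
HB.lock Definition toCinf (R : realType) (n : nat) (M : manifold R n)
  (g : M -> R) : Cinf M := insubd 0 g.

Lemma toCinfE (R : realType) (n : nat) (M : manifold R n) (g : M -> R) :
  smooth_on setT g -> toCinf g = g :> (M -> R).
Proof. by move=> sg; rewrite unlock insubdK //; exact/asboolP. Qed.

Section Tangent.
Context {R : realType} {n : nat} {M : manifold R n}.

Definition is_derivation_at (x : M) : {pred Cinf M -> R} := fun D =>
  `[< (forall (a : R) (f g : Cinf M), D (a *: f + g) = a * D f + D g) /\
      (forall f g : Cinf M, D (f * g) = D f * g x + f x * D g) >].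

Record tangent (x : M) :=
  MkTangent { tangent_fun :> Cinf M -> R; _ : tangent_fun \in is_derivation_at x }.

HB.instance Definition _ x := [isSub for @tangent_fun x].
HB.instance Definition _ x := [Choice of tangent x by <:].

Let is_derivation_submod x : submod_closed (@is_derivation_at x).
Proof.
split=> [|k D E]; rewrite /in_mem /=.
  apply/asboolP; split=> [a f g|f g].
    by rewrite /GRing.zero /= mulr0 addr0.
  by rewrite /GRing.zero /= mul0r mulr0 addr0.
move=> /asboolP[lD dD] /asboolP[lE dE]; apply/asboolP; split=> [a f g|f g].
  have S h : (k *: D + E) h = k * D h + E h by [].
  by rewrite !S lD lE !mulrDr mulrCA addrACA.
have S h : (k *: D + E) h = k * D h + E h by [].
by rewrite !S dD dE !mulrDr mulrDl mulrA [f x * (k * _)]mulrCA addrACA.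
Qed.

HB.instance Definition _ x := GRing.isSubmodClosed.Build R (Cinf M -> R)
  (is_derivation_at x) (is_derivation_submod x).
HB.instance Definition _ x := [SubChoice_isSubLmodule of tangent x by <:].

End Tangent.

Section Dual.
Context {R : realType} (V : lmodType R).

Definition is_linear : {pred V -> R} := fun h =>
  `[< forall (a : R) (u v : V), h (a *: u + v) = a * h u + h v >].

Record dual := MkDual { dual_fun :> V -> R; _ : dual_fun \in is_linear }.

HB.instance Definition _ := [isSub for dual_fun].
HB.instance Definition _ := [Choice of dual by <:].

Let is_linear_submod : submod_closed is_linear.
Proof.
split=> [|k g h]; rewrite /in_mem /=.
  by apply/asboolP => a u v; rewrite /GRing.zero /= mulr0 addr0.
move=> /asboolP lg /asboolP lh; apply/asboolP => a u v.
have S w : (k *: g + h) w = k * g w + h w by [].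
by rewrite !S lg lh !mulrDr mulrCA addrACA.
Qed.

HB.instance Definition _ := GRing.isSubmodClosed.Build R (V -> R)
  is_linear is_linear_submod.
HB.instance Definition _ := [SubChoice_isSubLmodule of dual by <:].

End Dual.

Program Definition transpose (R : realType) (V W : lmodType R)
    (u : {linear V -> W}) (a : dual W) : dual V :=
  @MkDual R V (fun v => a (u v)) _.
Next Obligation.
move=> R V W u [a /= la]; apply/asboolP => k v w /=.
by move/asboolP: la => la; rewrite linearP la.
Qed.

Section Exterior.
Context {R : realType} {V : lmodType R}.

(* The exterior algebra of a finite-dimensional V, seen as the algebra of     *)
(* alternating forms on V^*: an element is evaluated at finite sequences of   *)
(* covectors, its component of degree p being its restriction to sequences    *)
(* of size p.                                                                 *)
Definition ext := seq (dual V) -> R.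
Implicit Types (P Q : ext) (a : dual V) (s : seq (dual V)).

Definition homogeneous (p : nat) P :=
  [/\ forall s, size s != p -> P s = 0,
      forall s1 s2 (k : R) a b, P (s1 ++ (k *: a + b) :: s2) =
        k * P (s1 ++ a :: s2) + P (s1 ++ b :: s2) &
      forall s1 s2 s3 a, P (s1 ++ a :: s2 ++ a :: s3) = 0].

Definition ext0 (k : R) : ext := fun s => if s is [::] then k else 0.

Definition ext1 (v : V) : ext := fun s => if s is [:: a] then a v else 0.

Definition contract a P : ext := fun s => P (a :: s).

(* The wedge product, computed from the fact that the contraction by a        *)
(* covector is an antiderivation of degree -1:                                *)
(*   i_a (P ^ Q) = (i_a P) ^ Q + (-1)^p P ^ (i_a Q), p the degree of P.       *)
(* It is the product with (v1 ^ ... ^ vp)(a1, ..., ap) = det (ai vj).         *)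
Fixpoint wedge P Q s : R :=
  if s is a :: s' then
    wedge (contract a P) Q s' +
    wedge (fun t => (- 1) ^+ size t * P t) (contract a Q) s'
  else P [::] * Q [::].

Lemma wedge11 (v w : V) (a b : dual V) :
  wedge (ext1 v) (ext1 w) [:: a; b] = a v * b w - b v * a w.
Proof.
by rewrite /= /contract /= !(mul0r, mulr0, addr0, add0r, expr0, expr1, mulN1r,
  mulNr, mul1r).
Qed.

(* P^# a is the vector with <b, P^# a> = P(a, b) for all b *)
Definition sharp P a : V :=
  xget 0 [set v : V | forall b : dual V, b v = P [:: a; b]].

End Exterior.
Arguments ext {R} V.

Definition ext_map (R : realType) (V W : lmodType R) (u : {linear V -> W})
    (P : ext V) : ext W := fun s => P (map (transpose u) s).

(* Common interface to vector bundles, given by local frames, and to TM,      *)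
(* whose smooth sections are given by their action on functions.              *)
Record family (R : realType) (n : nat) (M : manifold R n) := Family {
  fiber :> M -> lmodType R;
  smooth_section : set (forall x, fiber x) }.

Section Sections.
Context {R : realType} {n : nat} {M : manifold R n} (B : family M).

Definition oneform := forall x, dual (B x).

(* Testing on global sections suffices: by bump functions, this is the same   *)
(* as smoothness in all local frames. Likewise for multivector fields.        *)
Definition smooth_form (t : oneform) := forall X, smooth_section X ->
  smooth_on setT (fun x => t x (X x)).

Definition mvfield := forall x, ext (B x).
Implicit Types P Q : mvfield.

Definition multivector (p : nat) P := (forall x, homogeneous p (P x)) /\
  forall t : nat -> oneform, (forall i, smooth_form (t i)) ->
    smooth_on setT (fun x => P x (mkseq (fun i => t i x) p)).

Definition mv_zero : mvfield := fun x s => 0.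
Definition mv_add P Q : mvfield := fun x s => P x s + Q x s.
Definition mv_scale (k : R) P : mvfield := fun x s => k * P x s.
Definition mv_wedge P Q : mvfield := fun x => wedge (P x) (Q x).
Definition mv_contract (t : oneform) P : mvfield := fun x => contract (t x) (P x).
Definition mv_fun (f : M -> R) : mvfield := fun x => ext0 (f x).
Definition mv_sec (X : forall x, B x) : mvfield := fun x => ext1 (X x).

End Sections.
Arguments mvfield {R n M} B.
Arguments oneform {R n M} B.
Arguments mv_zero {R n M B}.

Section TangentBundle.
Context {R : realType} {n : nat} (M : manifold R n).

Definition vector_field (X : forall x : M, tangent x) :=
  forall f : Cinf M, smooth_on setT (fun x => X x f).

Definition tangent_bundle : family M :=
  @Family R n M (fun x => tangent x) vector_field.

(* [X, Y] f = X (Y f) - Y (X f); meaningful for vector fields X and Y only *)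
Definition vf_bracket (X Y : forall x : M, tangent x) (x : M) : tangent x :=
  insubd 0 (fun f : Cinf M =>
    X x (toCinf (fun y => Y y f)) - Y x (toCinf (fun y => X y f))).

Lemma vf_bracketE X Y x (f : Cinf M) : vector_field X -> vector_field Y ->
  vf_bracket X Y x f =
  X x (toCinf (fun y => Y y f)) - Y x (toCinf (fun y => X y f)).
Proof.
move=> vX vY; pose act (Z : forall y : M, tangent y) g := toCinf (fun y => Z y g).
have TP (y : M) (D : tangent y) :
    (forall (a : R) (g h : Cinf M), D (a *: g + h) = a * D g + D h) /\
    (forall g h : Cinf M, D (g * h) = D g * h y + g y * D h).
  by case: D => D /= /asboolP.
have linE (a : R) (g h : Cinf M) y : (a *: g + h) y = a * g y + h y by [].
have mulE (g h : Cinf M) y : (g * h) y = g y * h y by [].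
have actE Z g y : vector_field Z -> act Z g y = Z y g.
  by move=> vZ; rewrite /act toCinfE.
have actL Z : vector_field Z -> forall (a : R) g h,
    act Z (a *: g + h) = a *: act Z g + act Z h.
  move=> vZ a g h; apply/val_inj/funext => y.
  have H : act Z (a *: g + h) y = a * act Z g y + act Z h y.
    by rewrite (actE Z _ y vZ) (actE Z g y vZ) (actE Z h y vZ) (TP _ (Z y)).1.
  exact: (etrans H (esym (linE a (act Z g) (act Z h) y))).
have actM Z : vector_field Z -> forall g h,
    act Z (g * h) = 1 *: (act Z g * h) + g * act Z h.
  move=> vZ g h; apply/val_inj/funext => y.
  have H : act Z (g * h) y = act Z g y * h y + g y * act Z h y.
    by rewrite (actE Z _ y vZ) (actE Z g y vZ) (actE Z h y vZ) (TP _ (Z y)).2.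
  apply: (etrans H); rewrite -(mul1r (act Z g y * h y)).
  exact: (esym (linE 1 (act Z g * h) (g * act Z h) y)).
rewrite /vf_bracket insubdK //; apply/asboolP; split=> [a g h|g h].
  rewrite -!/(act _ _) !actL // !(TP _ (X x)).1 !(TP _ (Y x)).1; ring.
rewrite -!/(act _ _) !actM // !(TP _ (X x)).1 !(TP _ (Y x)).1.
rewrite !(TP _ (X x)).2 !(TP _ (Y x)).2 !actE //; ring.
Qed.

End TangentBundle.

Section VectorBundle.
Context {R : realType} {n : nat} {M : manifold R n}.

Record local_frame (E : M -> lmodType R) (r : nat) := LocalFrame {
  fdom : set M;
  fvec : 'I_r -> forall x, E x;
  fdom_open : open fdom;
  fvec_basis : forall x, fdom x -> forall v : E x,
    exists! a : 'rV[R]_r, v = \sum_(i < r) a 0 i *: fvec i x }.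

Definition smooth_in_frame (E : M -> lmodType R) (r : nat)
    (e : local_frame E r) (U : set M) (X : forall x, E x) :=
  exists a : 'I_r -> M -> R, (forall i, smooth_on (U `&` fdom e) (a i)) /\
    forall x, (U `&` fdom e) x -> X x = \sum_(i < r) a i x *: fvec e i x.

Record vector_bundle := VectorBundle {
  vfiber : M -> lmodType R;
  vrank : nat;
  frames : set (local_frame vfiber vrank);
  frames_cover : forall x, exists2 e, frames e & fdom e x;
  frames_smooth : forall e e', frames e -> frames e' -> forall i,
    smooth_in_frame e (fdom e') (fvec e' i) }.

Definition bundle_family (E : vector_bundle) : family M :=
  @Family R n M (vfiber E)
    [set X | forall e, @frames E e -> smooth_in_frame e setT X].

End VectorBundle.
Arguments vector_bundle {R n} M.
Coercion bundle_family : vector_bundle >-> family.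

(* The operations of a Lie algebroid, without its axioms, so that the         *)
(* definitions below also apply to TM.                                        *)
Record algebroid_data (R : realType) (n : nat) (M : manifold R n) :=
  AlgebroidData {
    afamily :> family M;
    bracket : (forall x, afamily x) -> (forall x, afamily x) ->
      forall x, afamily x;
    anchor : forall x, {linear afamily x -> tangent x} }.

Definition tangent_algebroid (R : realType) (n : nat) (M : manifold R n) :
    algebroid_data M :=
  @AlgebroidData R n M (tangent_bundle M) (@vf_bracket R n M)
    (fun x => [the {linear tangent x -> tangent x} of idfun]).

Definition anchor_act (R : realType) (n : nat) (M : manifold R n)
    (L : algebroid_data M) (X : forall x, L x) (f : M -> R) : M -> R :=
  fun x => anchor L x (X x) (toCinf f).

Record lie_algebroid_axioms (R : realType) (n : nat) (M : manifold R n)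
    (L : algebroid_data M) (sec := @smooth_section R n M L) : Prop := {
  anchor_smooth : forall X, sec X -> vector_field (fun x => anchor L x (X x));
  bracket_smooth : forall X Y, sec X -> sec Y -> sec (bracket X Y);
  bracket_linear : forall (k : R) X Y Z, sec X -> sec Y -> sec Z -> forall x,
    bracket (fun y => k *: X y + Y y) Z x = k *: bracket X Z x + bracket Y Z x;
  bracket_anti : forall X Y, sec X -> sec Y -> forall x,
    bracket X Y x = - bracket Y X x;
  bracket_jacobi : forall X Y Z, sec X -> sec Y -> sec Z -> forall x,
    bracket X (bracket Y Z) x + bracket Y (bracket Z X) x +
    bracket Z (bracket X Y) x = 0;
  bracket_leibniz : forall X (f : Cinf M) Y, sec X -> sec Y -> forall x,
    bracket X (fun y => f y *: Y y) x =
    f x *: bracket X Y x + anchor_act X f x *: Y x }.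

Record lie_algebroid (R : realType) (n : nat) (M : manifold R n) :=
  LieAlgebroid {
    lbundle : vector_bundle M;
    lbracket : (forall x, lbundle x) -> (forall x, lbundle x) ->
      forall x, lbundle x;
    lanchor : forall x, {linear lbundle x -> tangent x};
    lie_algebroidP : lie_algebroid_axioms (AlgebroidData lbracket lanchor) }.

Definition algebroid_of (R : realType) (n : nat) (M : manifold R n)
    (A : lie_algebroid M) : algebroid_data M :=
  AlgebroidData (@lbracket R n M A) (@lanchor R n M A).
Coercion algebroid_of : lie_algebroid >-> algebroid_data.

Definition lie_d1 (R : realType) (n : nat) (M : manifold R n)
    (L : algebroid_data M) (t : oneform L) (X Y : forall x, L x) (x : M) : R :=
  anchor_act X (fun y => t y (Y y)) x - anchor_act Y (fun y => t y (X y)) x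
  - t x (bracket X Y x).

Record jacobi_algebroid (R : realType) (n : nat) (M : manifold R n) :=
  JacobiAlgebroid {
    jalgebroid :> lie_algebroid M;
    phi0 : oneform jalgebroid;
    phi0_smooth : smooth_form phi0;
    phi0_closed : forall X Y : forall x, jalgebroid x,
      smooth_section X -> smooth_section Y ->
      forall x, lie_d1 phi0 X Y x = 0 }.

Arguments phi0 {R n M} j x.

Section Schouten.
Context {R : realType} {n : nat} {M : manifold R n} (L : algebroid_data M).
Local Notation sec X := (@smooth_section R n M L X).
Local Notation mv := (@multivector R n M L).

(* These properties determine the Schouten bracket on smooth homogeneous      *)
(* multivector fields; its values elsewhere are irrelevant.                   *)
Record schouten := Schouten {
  sbracket :> mvfield L -> mvfield L -> mvfield L;
  sb_degree : forall p q P Q, mv p P -> mv q Q -> (0 < p + q)%N ->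
    mv (p + q - 1) (sbracket P Q);
  sb_degree0 : forall P Q, mv 0 P -> mv 0 Q -> sbracket P Q = mv_zero;
  sb_linear : forall p q P Q Q' (k : R), mv p P -> mv q Q -> mv q Q' ->
    sbracket P (mv_add (mv_scale k Q) Q') =
    mv_add (mv_scale k (sbracket P Q)) (sbracket P Q');
  sb_sections : forall X Y, sec X -> sec Y ->
    sbracket (mv_sec X) (mv_sec Y) = mv_sec (bracket X Y);
  sb_function : forall X (f : Cinf M), sec X ->
    sbracket (mv_sec X) (mv_fun f) = mv_fun (anchor_act X f);
  sb_skew : forall p q P Q, mv p P -> mv q Q ->
    sbracket P Q =
    mv_scale (- (- 1) ^ ((p%:Z - 1) * (q%:Z - 1))) (sbracket Q P);
  sb_leibniz : forall p q r P Q S, mv p P -> mv q Q -> mv r S ->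
    sbracket P (mv_wedge Q S) =
    mv_add (mv_wedge (sbracket P Q) S)
      (mv_scale ((- 1) ^ ((p%:Z - 1) * q%:Z)) (mv_wedge Q (sbracket P S))) }.

(* [P, Q]^t for P of degree p and Q of degree q *)
Definition schouten_jacobi (sb : schouten) (t : oneform L) (p q : nat)
    (P Q : mvfield L) : mvfield L :=
  mv_add (mv_add (sb P Q)
    (mv_scale (p%:R - 1) (mv_wedge P (mv_contract t Q))))
    (mv_scale (- ((- 1) ^ (p%:Z - 1) * (q%:R - 1)))
      (mv_wedge (mv_contract t P) Q)).

End Schouten.

Definition jacobi_bivector (R : realType) (n : nat) (M : manifold R n)
    (A : jacobi_algebroid M) (SA : schouten A) (P : mvfield A) :=
  multivector 2 P /\ schouten_jacobi SA (phi0 A) 2 2 P P = mv_zero.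

Definition compatible_jacobi_bivectors (R : realType) (n : nat)
    (M : manifold R n) (A : jacobi_algebroid M) (SA : schouten A)
    (P1 P2 : mvfield A) :=
  [/\ jacobi_bivector SA P1, jacobi_bivector SA P2 &
      schouten_jacobi SA (phi0 A) 2 2 P1 P2 = mv_zero].

Section JacobiStructures.
Context {R : realType} {n : nat} {M : manifold R n}.
Variable SM : schouten (tangent_algebroid M).
Implicit Types (Lambda : mvfield (tangent_bundle M))
  (E : forall x : M, tangent x).

Definition jacobi_structure Lambda E :=
  [/\ multivector 2 Lambda, vector_field E,
      SM Lambda Lambda =
        mv_scale (- 2) (mv_wedge (@mv_sec _ _ _ (tangent_bundle M) E) Lambda) &
      SM (@mv_sec _ _ _ (tangent_bundle M) E) Lambda = mv_zero].

Definition compatible_jacobi_structures Lambda1 E1 Lambda2 E2 :=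
  [/\ jacobi_structure Lambda1 E1, jacobi_structure Lambda2 E2 &
      jacobi_structure (mv_add Lambda1 Lambda2) (fun x => E1 x + E2 x)].

End JacobiStructures.

Definition induced_bivector (R : realType) (n : nat) (M : manifold R n)
    (A : jacobi_algebroid M) (P : mvfield A) : mvfield (tangent_bundle M) :=
  fun x => ext_map (anchor A x) (P x).

Definition induced_vector_field (R : realType) (n : nat) (M : manifold R n)
    (A : jacobi_algebroid M) (P : mvfield A) (x : M) : tangent x :=
  anchor A x (sharp (P x) (phi0 A x)).

(* Main.v *)
(* By polarization and since rho is linear in the bivector, it suffices to     *)
(* treat one bivector P, applied to P1, P2 and P1 + P2. Write v for the        *)
(* contraction of P by phi0. The Jacobi condition says [P, P] = - 2 v ^ P.     *)
(* Pushing it forward by rho, a morphism of Schouten brackets, gives the first *)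
(* Jacobi equation on M. As phi0 is closed, i_phi0 is a derivation of the      *)
(* Schouten bracket, hence 2 [v, P] = i_phi0 [P, P] = - 2 i_phi0 (v ^ P) = 0,  *)
(* which gives the second one. Both facts about the Schouten bracket are only  *)
(* accessible through its axioms on finite sums of wedges of global sections;  *)
(* a bump function g turns P into such a sum g P, and the Leibniz rule         *)
(* recovers g^2 [P, P] and g^2 [v, P] from brackets of g P, g v and g.         *)

Require Import Defs.
From HB Require Import structures.
From mathcomp Require Import all_boot all_order all_algebra.
From mathcomp Require Import all_classical all_reals topology normedtype derive.
From mathcomp Require Import sequences realfun exp.
From mathcomp Require Import ring lra.
Require Import Defs.
Set Implicit Arguments.
Unset Strict Implicit.
Unset Printing Implicit Defensive.
Import Order.TTheory GRing.Theory Num.Theory numFieldNormedType.Exports.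
Local Open Scope classical_set_scope.
Local Open Scope ring_scope.
Arguments mv_wedge {R n M B} P Q x _.
Arguments mv_fun {R n M B} f x _.
Arguments mv_sec {R n M B} X x _.
Arguments mv_add {R n M B} P Q x _.
Arguments mv_scale {R n M B} k P x _.
Arguments mv_contract {R n M B} t P x _.
Arguments sbracket {R n M L} s _ _ x _.

(** * Exterior algebra *)

(** Write [v] for the contraction of a bivector [P] by the cocycle [phi0]. Compatibility of [P1] and
    [P2] means that [P1], [P2] and [P1 + P2] all satisfy [[P, P] = - 2 v ∧ P]. As [P] determines its
    induced bivector and vector field additively, the theorem is three instances of
    [jacobi_structure_pushforward], a statement about one bivector.

    Two facts carry that statement. The anchor preserves Schouten brackets: on sections this is
    [anchor_bracket], and the Leibniz rule propagates it to bivectors ([natural_decomposable2]).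
    Contraction by [phi0] is a derivation of the bracket because [phi0] is closed
    ([contract_derivation_decomposable]); applied to the Jacobi equation it gives [2 [v, P] = 2 v ∧
    v = 0], since [v] itself contracts to zero.

    The axioms of the bracket speak of global fields, so both facts are proved for finite sums of
    wedges of global sections. By [locally_decomposable], each point has a function [g], nonzero
    there, for which [g P] is such a sum. [sb_mul2] and [sb_mul1] express [g^2 [P, P]] and [g^2
    [v, P]] through brackets of [g P], [g v] and [g], and [g^2] is cancelled at the point. The
    functions [g] come from bump functions built on [exp (-1/t)]. *)

Section ExteriorAlgebra.
Context {R : realType} {V : lmodType R}.
Implicit Types (P Q T : ext V) (a b : dual V) (v w : V) (s : seq (dual V)) (k : R).

Lemma dualP a k v w : a (k *: v + w) = k * a v + a w.
Proof. by case: a => f /= /asboolP. Qed.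

Lemma dual0 a : a 0 = 0.
Proof.
by have := dualP a (-1) 0 0; rewrite scaler0 addr0 mulN1r addNr.
Qed.

Lemma dualZ a k v : a (k *: v) = k * a v.
Proof. by rewrite -[k *: v]addr0 dualP dual0 addr0. Qed.

Lemma dualD a v w : a (v + w) = a v + a w.
Proof. by rewrite -[v in a (v + w)]scale1r dualP mul1r. Qed.

Lemma wedge_linl k P P' Q s :
  wedge (fun t => k * P t + P' t) Q s = k * wedge P Q s + wedge P' Q s.
Proof.
elim: s P P' Q => [|a s IH] P P' Q /=; first by ring.
rewrite (IH (contract a P) (contract a P') Q).
rewrite (_ : (fun t => _ * (k * P t + P' t)) =
  (fun t => k * ((- 1) ^+ size t * P t) + (- 1) ^+ size t * P' t)).
  by rewrite IH; ring.
by apply/funext => t; ring.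
Qed.

Lemma wedge_linr k P Q Q' s :
  wedge P (fun t => k * Q t + Q' t) s = k * wedge P Q s + wedge P Q' s.
Proof.
elim: s P Q Q' => [|a s IH] P Q Q' /=; first by ring.
by rewrite IH (IH _ (contract a Q) (contract a Q')); ring.
Qed.

Lemma wedge0l Q s : wedge (fun=> 0) Q s = 0.
Proof.
have := wedge_linl (-1) (fun=> 0) (fun=> 0) Q s.
by rewrite (_ : (fun t => _) = fun=> 0) ?mulN1r ?addNr//; apply/funext => t; ring.
Qed.

Lemma wedge0r P s : wedge P (fun=> 0) s = 0.
Proof.
have := wedge_linr (-1) P (fun=> 0) (fun=> 0) s.
by rewrite (_ : (fun t => _) = fun=> 0) ?mulN1r ?addNr//; apply/funext => t; ring.
Qed.

Lemma wedgeZl k P Q s : wedge (fun t => k * P t) Q s = k * wedge P Q s.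
Proof.
rewrite -[RHS]addr0 -(wedge0l Q s) -wedge_linl.
by congr (wedge _ _ _); apply/funext => t; rewrite addr0.
Qed.

Lemma wedge_ext0l k Q s : wedge (ext0 k) Q s = k * Q s.
Proof.
elim: s Q => [|a s IH] Q //=.
rewrite (_ : contract a (ext0 k) = fun=> 0); last by apply/funext.
rewrite wedge0l add0r (_ : (fun t => _) = ext0 k) ?IH//.
by apply/funext => -[|b t]; rewrite /= ?mul1r ?mulr0.
Qed.

Lemma wedge_ext0r k P s : wedge P (ext0 k) s = k * P s.
Proof.
elim: s P => [|a s IH] P /=; first by rewrite mulrC.
rewrite IH (_ : contract a (ext0 k) = fun=> 0); last by apply/funext.
by rewrite wedge0r addr0.
Qed.

Lemma contract_ext1 a v : contract a (ext1 v) = ext0 (a v).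
Proof. by apply/funext => -[|b t]. Qed.

(** The recursion of [wedge] keeps the sign [(- 1) ^+ size t] inside the first factor; a homogeneous
    [P] vanishes unless [size t = p], so the sign comes out as a constant. *)
Lemma contract_wedge p P Q a s : homogeneous p P ->
  contract a (wedge P Q) s =
  wedge (contract a P) Q s + (- 1) ^+ p * wedge P (contract a Q) s.
Proof.
move=> [P0 _ _]; rewrite /contract /= -/(contract a P) -/(contract a Q).
rewrite -wedgeZl; congr (_ + wedge _ _ _); apply/funext => t.
by have [-> //|/P0 ->] := eqVneq (size t) p; rewrite !mulr0.
Qed.

Lemma homogeneous_contract p P a :
  homogeneous p.+1 P -> homogeneous p (contract a P).
Proof.
move=> [P0 Pl Pa]; split=> [s sp|s1 s2 k b c|s1 s2 s3 b].
- by apply: P0; rewrite /= eqSS.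
- exact: (Pl (a :: s1)).
- exact: (Pa (a :: s1)).
Qed.

Lemma homogeneous0E P : homogeneous 0 P -> P = ext0 (P [::]).
Proof. by move=> [P0 _ _]; apply/funext => -[|a s] //=; rewrite P0. Qed.

Lemma homogeneous_ext0 k : homogeneous 0 (ext0 k : ext V).
Proof.
by split=> [[]//|s1 s2 l a b|s1 s2 s3 a]; case: s1 => [|? ?] /=; ring.
Qed.

Lemma homogeneous_ext1 v : homogeneous 1 (ext1 v).
Proof.
split=> [[|? []]//|s1 s2 l a b|s1 s2 s3 a].
  by case: s1 => [|? [|? ?]] /=; case: s2 => [|? ?] /=; rewrite ?mulr0 ?addr0.
by case: s1 => [|? [|? ?]] //=; case: s2.
Qed.

Lemma wedge_ext1 v w a s :
  wedge (ext1 v) (ext1 w) (a :: s) = a v * ext1 w s - a w * ext1 v s.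
Proof.
have := contract_wedge (ext1 w) a s (homogeneous_ext1 v).
rewrite /contract => -> /=; rewrite -/(contract a _) -/(contract a (ext1 v)).
by rewrite !contract_ext1 wedge_ext0l wedge_ext0r expr1 mulN1r.
Qed.

Lemma homogeneous_wedge_ext1 v w : homogeneous 2 (wedge (ext1 v) (ext1 w)).
Proof.
split=> [s|s1 s2 l a b|s1 s2 s3 a].
- case: s => [|a [|b [|c s]]] // _; first by rewrite /= mulr0.
    by rewrite wedge_ext1 /=; ring.
  by rewrite wedge_ext1 /=; ring.
- case: s1 => [|c [|d s1]]; rewrite ?cat0s ?cat_cons !wedge_ext1.
  + have E u : (l *: a + b) u = l * a u + b u by [].
    by rewrite !E; ring.
  + case: s2 => [|? ?] /=; last by ring.
    transitivity (c v * (l * a w + b w) - c w * (l * a v + b v)) => //.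
    by ring.
  + by case: s1 => [|? ?] /=; ring.
- case: s1 => [|c [|d s1]]; rewrite ?cat0s ?cat_cons !wedge_ext1.
  + case: s2 => [|? [|? ?]]; rewrite /= ?mulr0 ?subrr//.
    by case: s3 => [|? ?] /=; ring.
  + by case: s2 => [|? ?] /=; ring.
  + by case: s1 => [|? ?] /=; ring.
Qed.

(** Contracting by the first covector of [s] leaves products with scalars, which commute. The same
    contraction reduces [homogeneous2_wedgeC] to this lemma. *)
Lemma homogeneous1_wedgeC P Q s :
  homogeneous 1 P -> homogeneous 1 Q -> wedge P Q s = - wedge Q P s.
Proof.
move=> hP hQ; case: s => [|a s].
  by case: hP hQ => P0 _ _ [Q0 _ _]; rewrite /= P0// Q0// mulr0 oppr0.
have := contract_wedge Q a s hP; have := contract_wedge P a s hQ.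
rewrite /contract -!/(contract a _) => -> ->.
rewrite (homogeneous0E (homogeneous_contract a hP)).
rewrite (homogeneous0E (homogeneous_contract a hQ)).
by rewrite !wedge_ext0l !wedge_ext0r; ring.
Qed.

Lemma homogeneous2_wedgeC P Q s :
  homogeneous 2 P -> homogeneous 1 Q -> wedge P Q s = wedge Q P s.
Proof.
move=> hP hQ; case: s => [|a s].
  by case: hP hQ => P0 _ _ [Q0 _ _]; rewrite /= P0// Q0// mulr0.
have := contract_wedge Q a s hP; have := contract_wedge P a s hQ.
rewrite /contract -!/(contract a _) => -> ->.
rewrite (homogeneous1_wedgeC s (homogeneous_contract a hP) hQ).
rewrite (homogeneous0E (homogeneous_contract a hQ)).
by rewrite !wedge_ext0l !wedge_ext0r; ring.
Qed.

Lemma homogeneous1_wedgeP P s : homogeneous 1 P -> wedge P P s = 0.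
Proof.
move=> hP; apply/eqP; have /eqP := homogeneous1_wedgeC s hP hP.
by rewrite -addr_eq0 -mulr2n mulrn_eq0.
Qed.

End ExteriorAlgebra.

(** * Functoriality of the exterior algebra *)

Section ExtMap.
Context {R : realType} {V W : lmodType R} (u : {linear V -> W}).

Lemma ext_map_wedge (P Q : ext V) :
  ext_map u (wedge P Q) = wedge (ext_map u P) (ext_map u Q).
Proof.
apply/funext => s; elim: s P Q => [//|a s IH] P Q.
have /= := congr2 +%R (IH (contract (transpose u a) P) Q)
  (IH (fun t => (- 1) ^+ size t * P t) (contract (transpose u a) Q)).
rewrite /ext_map /= => ->; congr (_ + wedge _ _ _).
by apply/funext => t; rewrite size_map.
Qed.

Lemma ext_map1 (v : V) : ext_map u (ext1 v) = ext1 (u v).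
Proof. by apply/funext => -[|a [|b s]]. Qed.

Lemma ext_map0 (k : R) : ext_map u (ext0 k) = ext0 k.
Proof. by apply/funext => -[|a s]. Qed.

Lemma homogeneous_ext_map p (P : ext V) :
  homogeneous p P -> homogeneous p (ext_map u P).
Proof.
move=> [P0 Pl Pa]; split=> [s sp|s1 s2 k a b|s1 s2 s3 a].
- by apply: P0; rewrite size_map.
- rewrite /ext_map !map_cat /= -Pl; congr (P (_ ++ _ :: _)).
  exact/val_inj/funext.
- by rewrite /ext_map map_cat /= map_cat /= Pa.
Qed.

End ExtMap.

(** * Schouten brackets *)

Section Multivectors.
Context {R : realType} {n : nat} {M : manifold R n} (B : family M).
Implicit Types (P Q : mvfield B) (f : M -> R) (k : R).
Local Notation sec := (@smooth_section R n M B).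
Local Notation mv := (@multivector R n M B).

Lemma mvP P Q : (forall x s, P x s = Q x s) -> P = Q.
Proof.
by move=> PQ; apply/functional_extensionality_dep => x; exact/funext/PQ.
Qed.

Lemma smooth_onMT f g : smooth_on setT f -> smooth_on setT g ->
  smooth_on setT (fun x : M => f x * g x).
Proof. exact: smooth_onM openT. Qed.

Lemma smooth_onDT f g : smooth_on setT f -> smooth_on setT g ->
  smooth_on setT (fun x : M => f x + g x).
Proof. exact: smooth_onD openT. Qed.

Lemma smooth_onZT k f : smooth_on setT f -> smooth_on setT (fun x : M => k * f x).
Proof. exact: (smooth_onMT (@smooth_on_cst R n M setT k)). Qed.

Lemma smooth_onNT f : smooth_on setT f -> smooth_on setT (fun x : M => - f x).
Proof.
by move=> /(smooth_onZT (-1)); congr smooth_on; apply/funext => x; rewrite mulN1r.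
Qed.

Lemma Cinf_smooth (f : Cinf M) : smooth_on setT f.
Proof. by case: f => f /= /asboolP. Qed.

Lemma toCinfK (f : Cinf M) : toCinf f = f.
Proof. by apply/val_inj; exact/toCinfE/Cinf_smooth. Qed.

Lemma multivector0 p : mv p mv_zero.
Proof.
split=> [x|t _]; last exact: (@smooth_on_cst R n M).
by split=> *; rewrite ?/mv_zero ?mulr0 ?addr0.
Qed.

Lemma multivector_lin p k P Q : mv p P -> mv p Q ->
  mv p (mv_add (mv_scale k P) Q).
Proof.
move=> [hP sP] [hQ sQ]; split=> [x|t st].
  have [P0 Pl Pa] := hP x; have [Q0 Ql Qa] := hQ x.
  rewrite /mv_add /mv_scale; split=> [s sp|s1 s2 l a b|s1 s2 s3 a].
  - by rewrite P0// Q0// mulr0 addr0.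
  - by rewrite Pl Ql; ring.
  - by rewrite Pa Qa mulr0 addr0.
by apply: smooth_onDT (sQ _ st); apply: smooth_onZT; exact: sP.
Qed.

Lemma mv_wedge_funE f P (x : M) (s : seq (dual (B x))) :
  mv_wedge (mv_fun f) P x s = f x * P x s.
Proof. by rewrite /mv_wedge wedge_ext0l. Qed.

Lemma multivector_mul p f P : smooth_on setT f -> mv p P ->
  mv p (mv_wedge (mv_fun f) P).
Proof.
move=> sf [hP sP]; split=> [x|t st].
  have [P0 Pl Pa] := hP x.
  split=> [s sp|s1 s2 l a b|s1 s2 s3 a]; rewrite !mv_wedge_funE.
  - by rewrite P0// mulr0.
  - by rewrite Pl; ring.
  - by rewrite Pa mulr0.
have := smooth_onMT sf (sP t st); congr smooth_on.
by apply/funext => x; rewrite mv_wedge_funE.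
Qed.

Lemma multivector_sec X : sec X -> mv 1 (mv_sec X).
Proof.
by move=> sX; split=> [x|t st]; [exact: homogeneous_ext1|exact: st].
Qed.

Lemma multivector_fun f : smooth_on setT f -> mv 0 (mv_fun f).
Proof. by move=> sf; split=> [x|t st]; [exact: homogeneous_ext0|]. Qed.

Lemma multivector_wedge X Y : sec X -> sec Y ->
  mv 2 (mv_wedge (mv_sec X) (mv_sec Y)).
Proof.
move=> sX sY; split=> [x|t st]; first exact: homogeneous_wedge_ext1.
rewrite (_ : (fun x => _) = fun x => t 0 x (X x) * t 1 x (Y x) +
    - (t 1 x (X x) * t 0 x (Y x))).
  by apply: smooth_onDT; [|apply: smooth_onNT]; apply: smooth_onMT; exact: st.
by apply/funext => x; rewrite /mv_wedge /mv_sec /mkseq [iota _ _]/= wedge11.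
Qed.

Lemma multivector_contract p (t : oneform B) P : smooth_form t -> mv p.+1 P ->
  mv p (mv_contract t P).
Proof.
move=> st [hP sP]; split=> [x|u su]; first exact: homogeneous_contract.
(* Prepending [t] to the test forms turns a value of the contraction into a value of [P]. *)
pose tu i := if i is j.+1 then u j else t.
have stu i : smooth_form (tu i) by case: i.
have := sP tu stu; congr smooth_on; apply/funext => x.
by rewrite /mv_contract /contract /mkseq /= (iotaDl 1 0) -map_comp.
Qed.

End Multivectors.

Section Schouten.
Context {R : realType} {n : nat} {M : manifold R n} {L : algebroid_data M}.
Variable S : schouten L.
Implicit Types (P Q T : mvfield L) (f g : Cinf M) (k : R) (x : M).
Local Notation sec := (@smooth_section R n M L).
Local Notation mv := (@multivector R n M L).
Local Notation "P ∧ Q" := (mv_wedge P Q) (at level 40, left associativity).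
Local Notation fn := (@mv_fun R n M L).
Local Notation sc := (@mv_sec R n M L).

Lemma mv_funP f : mv 0 (fn f).
Proof. exact/multivector_fun/Cinf_smooth. Qed.

Lemma sbr0 p P : mv p P -> S P mv_zero = mv_zero.
Proof.
move=> mP; have m0 := @multivector0 R n M L 0.
have := sb_linear S (-1) mP m0 m0.
rewrite (_ : mv_add _ _ = mv_zero) => [->|].
  by apply: mvP => x s; rewrite /mv_add /mv_scale mulN1r addNr.
by apply: mvP => x s; rewrite /mv_add /mv_scale mulr0 addr0.
Qed.

Lemma sb_linear_l p q P P' Q k : mv p P -> mv p P' -> mv q Q ->
  S (mv_add (mv_scale k P) P') Q = mv_add (mv_scale k (S P Q)) (S P' Q).
Proof.
move=> mP mP' mQ.
rewrite (sb_skew S (multivector_lin k mP mP') mQ) (sb_linear S k mQ mP mP').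
rewrite (sb_skew S mP mQ) (sb_skew S mP' mQ).
by apply: mvP => x s; rewrite /mv_add /mv_scale; ring.
Qed.

Lemma sb0l p P : mv p P -> S mv_zero P = mv_zero.
Proof.
move=> mP; rewrite (sb_skew S (@multivector0 R n M L p) mP) (sbr0 mP).
by apply: mvP => x s; rewrite /mv_scale mulr0.
Qed.

Ltac signs := rewrite /exprz /= ?(expr0, expr1, invrN, invr1, opprK, mulN1r,
  mul1r, sqrrN, expr1n, mulNr).

Lemma sb_fun_sec f X : sec X -> forall x s,
  S (fn f) (sc X) x s = - fn (anchor_act X f) x s.
Proof.
move=> sX x s; rewrite (sb_skew S (mv_funP f) (multivector_sec sX)).
by rewrite sb_function// /mv_scale; signs.
Qed.

Lemma sb_skew2 p P Q : mv 2 P -> mv p Q -> forall x s,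
  S Q P x s = (- 1) ^+ p * S P Q x s.
Proof.
move=> mP mQ x s; rewrite (sb_skew S mQ mP) /mv_scale; congr (_ * _).
(* For [p = 0] the exponent [p - 1] is negative and the sign is an inverse power. *)
case: p {mQ} => [|p]; first by signs.
rewrite (_ : _ * _ = p%:Z); last by rewrite -addn1 PoszD addrK mulr1.
by rewrite -exprnP exprS mulN1r.
Qed.

Lemma sb_skew1 q P Q : mv 1 P -> mv q Q -> forall x s, S P Q x s = - S Q P x s.
Proof.
move=> mP mQ x s; rewrite (sb_skew S mP mQ) /mv_scale subrr mul0r expr0z.
by rewrite mulN1r.
Qed.

Lemma sb_leibniz0 q r f Q T : mv q Q -> mv r T -> forall x s,
  S (fn f) (Q ∧ T) x s =
  wedge (S (fn f) Q x) (T x) s + (- 1) ^+ q * wedge (Q x) (S (fn f) T x) s.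
Proof.
move=> mQ mT x s; rewrite (sb_leibniz S (mv_funP f) mQ mT).
rewrite /mv_add /mv_scale /mv_wedge; congr (_ + _ * _).
by rewrite sub0r mulN1r -invr_expz -exprnP -signr_odd; case: odd; signs.
Qed.

Lemma sb_leibniz1 q r P Q T : mv 1 P -> mv q Q -> mv r T -> forall x s,
  S P (Q ∧ T) x s = wedge (S P Q x) (T x) s + wedge (Q x) (S P T x) s.
Proof.
move=> mP mQ mT x s; rewrite (sb_leibniz S mP mQ mT).
by rewrite /mv_add /mv_scale /mv_wedge subrr mul0r expr0z mul1r.
Qed.

Lemma sb_leibniz2 q r P Q T : mv 2 P -> mv q Q -> mv r T -> forall x s,
  S P (Q ∧ T) x s =
  wedge (S P Q x) (T x) s + (- 1) ^+ q * wedge (Q x) (S P T x) s.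
Proof.
move=> mP mQ mT x s; rewrite (sb_leibniz S mP mQ mT).
rewrite /mv_add /mv_scale /mv_wedge; congr (_ + _ * _).
by rewrite (_ : 2%:Z - 1 = 1) ?mul1r -?exprnP.
Qed.

(* [D, g] for D = g P determines [P, g], hence [P, P] from [D, D]. *)
Lemma sb_mul_fun g P : mv 2 P -> forall x s,
  S (fn g ∧ P) (fn g) x s = g x * S P (fn g) x s.
Proof.
move=> mP x s; have mD := multivector_mul (Cinf_smooth g) mP.
rewrite -[LHS]mul1r -[1](expr0 (-1)) -(sb_skew2 mD (mv_funP g)).
rewrite (sb_leibniz0 g (mv_funP g) mP).
rewrite (sb_degree0 S (mv_funP g) (mv_funP g)) wedge0l add0r wedge_ext0l.
rewrite expr0 mul1r (funext (fun s' : seq (dual (L x)) => sb_skew2 mP (mv_funP g) s')).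
by rewrite expr0 mul1r.
Qed.

(** The Leibniz rule in each argument; the two terms that differentiate [g] coincide because the
    bracket of bivectors is symmetric. *)
Lemma sb_mul2 g P : mv 2 P -> forall x s,
  S (fn g ∧ P) (fn g ∧ P) x s =
  2 * wedge (S (fn g ∧ P) (fn g) x) (P x) s + g x * (g x * S P P x s).
Proof.
move=> mP x s; have mD := multivector_mul (Cinf_smooth g) mP.
rewrite (sb_leibniz2 mD (mv_funP g) mP) wedge_ext0l expr0 mul1r.
rewrite (sb_skew2 mP mD) sqrrN expr1n mul1r.
rewrite (sb_leibniz2 mP (mv_funP g) mP) wedge_ext0l expr0 mul1r.
rewrite (funext (fun s' : seq (dual (L x)) => sb_mul_fun g mP s')) wedgeZl; ring.
Qed.

(** The same expansion for a vector and a bivector, solved for [g^2 [E, P]] so that only brackets of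
    [g E], [g P] and [g] remain on the right. *)
Lemma sb_mul1 g E P : mv 1 E -> mv 2 P -> forall x s,
  g x * (g x * S E P x s) = S (fn g ∧ E) (fn g ∧ P) x s
    - wedge (S (fn g ∧ E) (fn g) x) (P x) s
    + wedge (S (fn g ∧ P) (fn g) x) (E x) s.
Proof.
move=> mE mP x s; have mgE := multivector_mul (Cinf_smooth g) mE.
rewrite (sb_leibniz1 mgE (mv_funP g) mP) wedge_ext0l.
rewrite (sb_skew2 mP mgE) (sb_leibniz2 mP (mv_funP g) mE).
rewrite wedge_ext0l expr0 mul1r expr1 !mulN1r.
rewrite (sb_skew2 mP mE) expr1 mulN1r.
rewrite (funext (fun s' : seq (dual (L x)) => sb_mul_fun g mP s')) wedgeZl; ring.
Qed.

(** The bivectors whose brackets can be computed from the axioms of [schouten] by induction, since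
    these give the bracket on global sections and functions. [locally_decomposable] brings any
    bivector of a Lie algebroid into this class up to a factor. *)
Inductive decomposable : mvfield L -> Prop :=
| decomposable0 : decomposable mv_zero
| decomposableD k X Y P : sec X -> sec Y -> decomposable P ->
    decomposable (mv_add (mv_scale k (sc X ∧ sc Y)) P).

Lemma multivector_decomposable P : decomposable P -> mv 2 P.
Proof.
elim=> [|k X Y Q sX sY _ mQ]; first exact: multivector0.
exact: multivector_lin (multivector_wedge sX sY) mQ.
Qed.

End Schouten.

(** * The anchor is a morphism of Lie brackets *)

Section LieAlgebroid.
Context {R : realType} {n : nat} {M : manifold R n} {A : lie_algebroid M}.
Implicit Types (f g : Cinf M) (X Y Z U V : forall x, A x) (x : M).
Local Notation sec := (@smooth_section R n M A).

Lemma tangentP x (D E : tangent x) : (forall f, D f = E f) -> D = E.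
Proof. by move=> DE; apply/val_inj/funext. Qed.

Lemma algebroidP : lie_algebroid_axioms A.
Proof. exact: lie_algebroidP. Qed.

Lemma smooth_on_sub (U W : set M) (f : M -> R) :
  U `<=` W -> smooth_on W f -> smooth_on U f.
Proof.
move=> UW sf c ac s _ [y [Uy cy] <-]; apply: (sf c ac s).
by exists y => //; split => //; exact: UW.
Qed.

Lemma smooth_sectionZ (f : M -> R) X :
  smooth_on setT f -> sec X -> sec (fun x => f x *: X x).
Proof.
move=> sf sX e fe; have [a [sa aE]] := sX e fe.
exists (fun i x => f x * a i x); split=> [i|x xe].
  apply: smooth_onM (sa i); first by rewrite setTI; exact: fdom_open.
  by apply: smooth_on_sub sf; rewrite setTI.
by rewrite aE// scaler_sumr; apply: eq_bigr => i _; rewrite scalerA.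
Qed.

Lemma bracketDr X U V x : sec X -> sec U -> sec V ->
  sec (fun y => U y + V y) ->
  bracket X (fun y => U y + V y) x = bracket X U x + bracket X V x.
Proof.
move=> sX sU sV sUV; have L := algebroidP.
rewrite (bracket_anti L sX sUV) (bracket_anti L sX sU) (bracket_anti L sX sV).
rewrite -opprD; congr (- _).
have := bracket_linear L 1 sU sV sX x; rewrite scale1r => <-.
congr (bracket _ X x).
by apply: functional_extensionality_dep => y; rewrite scale1r.
Qed.

Lemma bracketNr X U x : sec X -> sec U ->
  bracket X (fun y => - U y) x = - bracket X U x.
Proof.
move=> sX sU; have L := algebroidP.
have sN : sec (fun y => - U y).
  have := smooth_sectionZ (@smooth_on_cst R n M setT (- 1)) sU.
  congr (sec _); apply: functional_extensionality_dep => y.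
  by rewrite scaleN1r.
rewrite (bracket_anti L sX sN) (bracket_anti L sX sU).
(* [- U] is written as [(- 2) U + U], which has the shape [k X + Y] required by [bracket_linear]. *)
have := bracket_linear L (- 2) sU sU sX x.
rewrite -[X in _ + X]scale1r -scalerDl (_ : - 2 + 1 = - 1 :> R); last by ring.
rewrite scaleN1r => <-; congr (- bracket _ X x).
apply: functional_extensionality_dep => y.
by rewrite -[X in _ + X]scale1r -scalerDl (_ : - 2 + 1 = - 1 :> R) ?scaleN1r//; ring.
Qed.

Lemma anchor_act_smooth f X : sec X -> smooth_on setT (anchor_act X f).
Proof.
by move=> sX; rewrite /anchor_act; exact: (anchor_smooth (algebroidP) sX).
Qed.

Lemma bracketZr X Y f x : sec X -> sec Y ->
  bracket X (fun y => f y *: Y y) x =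
  f x *: bracket X Y x + anchor_act X f x *: Y x.
Proof. by move=> sX sY; exact: (bracket_leibniz (algebroidP)). Qed.

Lemma bracket2Zr X Y Z f x : sec X -> sec Y -> sec Z ->
  bracket X (bracket Y (fun y => f y *: Z y)) x =
  f x *: bracket X (bracket Y Z) x + anchor_act X f x *: bracket Y Z x
  + (anchor_act Y f x *: bracket X Z x
     + anchor_act X (toCinf (anchor_act Y f)) x *: Z x).
Proof.
move=> sX sY sZ; have L := algebroidP.
have sYZ := bracket_smooth L sY sZ.
have sYf := anchor_act_smooth f sY.
have E : bracket Y (fun y => f y *: Z y) =
    fun y => f y *: bracket Y Z y + toCinf (anchor_act Y f) y *: Z y.
  apply: functional_extensionality_dep => y.
  by rewrite bracketZr// toCinfE.
(* The sum in [E] is a smooth section because it is the bracket of [Y] with [f Z]. *)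
have := bracket_smooth L sY (smooth_sectionZ (Cinf_smooth f) sZ).
rewrite E => sE.
rewrite bracketDr//.
- by rewrite !bracketZr// toCinfE.
- exact: smooth_sectionZ (Cinf_smooth f) sYZ.
- exact: smooth_sectionZ (Cinf_smooth _) sZ.
Qed.

(* Compare the Jacobi identities of X, Y, Z and of X, Y, f Z at a point where *)
(* Z does not vanish; if there is no such Z, then all sections vanish there.  *)
Lemma anchor_bracket X Y x : sec X -> sec Y ->
  anchor A x (bracket X Y x) =
  vf_bracket (fun y => anchor A y (X y)) (fun y => anchor A y (Y y)) x.
Proof.
move=> sX sY; have L := algebroidP.
have vX := anchor_smooth L sX; have vY := anchor_smooth L sY.
have sXY := bracket_smooth L sX sY.
apply: tangentP => f; rewrite vf_bracketE//.
have [[Z [sZ Zx]]|noZ] := pselect (exists Z, sec Z /\ Z x <> 0); last first.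
  have Z0 Z : sec Z -> Z x = 0.
    by move=> sZ; apply: contrapT => Zx; apply: noZ; exists Z.
  rewrite (Z0 _ sX) (Z0 _ sY) (Z0 _ sXY) !linear0.
  by transitivity (0 + 0 : R) => //; rewrite addr0.
have sfZ := smooth_sectionZ (Cinf_smooth f) sZ.
have sXfZ := bracket_smooth L sX sfZ.
have J0 := bracket_jacobi L sX sY sZ x.
have := bracket_jacobi L sX sY sfZ x.
have anti W : sec W -> bracket Y (bracket W X) x = - bracket Y (bracket X W) x.
  move=> sW; rewrite -bracketNr//; last exact: (bracket_smooth L sX sW).
  congr (bracket Y _ x); apply: functional_extensionality_dep => y.
  exact: (bracket_anti L).
rewrite (anti Z sZ) in J0; rewrite (anti _ sfZ).
rewrite (bracket_anti L sfZ sXY) (bracket_anti L sZ sXY) in J0 *.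
rewrite !bracket2Zr// bracketZr//.
(* The multiples of [f] ([a], [d], [e]) form the Jacobi identity of [X, Y, Z], the mixed terms [b]
   and [c] cancel, and [u - v - w] is [X(Yf) - Y(Xf) - [X, Y]f] times [Z]. *)
have rearr (V : zmodType) (a b c d e u v w : V) :
    (a + b + (c + u)) - (d + c + (b + v)) - (e + w) =
    (a - d - e) + (u - v - w).
  have -> : a + b + (c + u) = (a + u) + (b + c).
    by rewrite [c + u]addrC addrACA.
  have -> : d + c + (b + v) = (d + v) + (b + c).
    by rewrite [b + v]addrC addrACA [c + b]addrC.
  rewrite (opprD (d + v)) addrACA subrr addr0 (opprD d) addrACA (opprD e).
  exact: addrACA.
rewrite rearr -!scalerBr J0 scaler0 add0r -!scalerBl => /eqP.
rewrite scaler_eq0 => /orP[|/eqP//]; rewrite subr_eq0 => /eqP.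
by rewrite /anchor_act !toCinfK.
Qed.
End LieAlgebroid.

(** * The anchor is a morphism of Schouten brackets *)

Section Naturality.
Context {R : realType} {n : nat} {M : manifold R n} {A : lie_algebroid M}.
Variables (SA : schouten A) (SM : schouten (tangent_algebroid M)).
Implicit Types (P Q T : mvfield A) (f g : Cinf M) (X Y : forall x, A x) (x : M).
Local Notation sec := (@smooth_section R n M A).
Local Notation mv := (@multivector R n M A).
Local Notation "P ∧ Q" := (mv_wedge P Q) (at level 40, left associativity).

(** This agrees with [induced_bivector] by computation, but is typed over the algebroid so that [SM]
    applies, and serves in every degree. *)
Definition pushforward P : mvfield (tangent_algebroid M) :=
  fun x => ext_map (anchor A x) (P x).
Local Notation rho := pushforward.

Lemma multivector_pushforward p P : mv p P -> multivector p (rho P).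
Proof.
move=> [hP sP]; split=> [x|t st]; first exact: homogeneous_ext_map.
have st' i : smooth_form (fun x => transpose (anchor A x) (t i x) : dual (A x)).
  by move=> X sX; apply: (st i); exact: (anchor_smooth (lie_algebroidP A) sX).
have := sP _ st'; congr smooth_on; apply/funext => x.
by rewrite /rho /ext_map /mkseq -map_comp.
Qed.

Lemma pushforward_wedge P Q : rho (P ∧ Q) = rho P ∧ rho Q.
Proof. by apply: mvP => x s; rewrite /rho /mv_wedge ext_map_wedge. Qed.

Lemma pushforward_sec X :
  rho (mv_sec X) = @mv_sec R n M (tangent_algebroid M) (fun x => anchor A x (X x)).
Proof. by apply: mvP => x s; rewrite /rho /mv_sec ext_map1. Qed.

Lemma pushforward_fun (f : M -> R) : rho (mv_fun f) = mv_fun f.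
Proof. by apply: mvP => x s; rewrite /rho /mv_fun ext_map0. Qed.

(** Stated for one pair because it is closed under exchange of the arguments, linear combinations
    and wedges; it thus spreads from functions and sections to decomposable bivectors. *)
Definition pushforward_natural P Q := rho (SA P Q) = SM (rho P) (rho Q).

Lemma natural_skew p q P Q : mv p P -> mv q Q ->
  pushforward_natural P Q -> pushforward_natural Q P.
Proof.
move=> mP mQ N; rewrite /pushforward_natural (sb_skew SA mQ mP).
rewrite (sb_skew SM (multivector_pushforward mQ) (multivector_pushforward mP)).
by rewrite -N.
Qed.

Lemma natural_lin p q k P Q T : mv p P -> mv q Q -> mv q T ->
  pushforward_natural P Q -> pushforward_natural P T ->
  pushforward_natural P (mv_add (mv_scale k Q) T).
Proof.
move=> mP mQ mT N1 N2; rewrite /pushforward_natural (sb_linear SA k mP mQ mT).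
have mp := @multivector_pushforward.
by have := sb_linear SM k (mp _ _ mP) (mp _ _ mQ) (mp _ _ mT); rewrite -N1 -N2.
Qed.

Lemma natural_wedge p q r P Q T : mv p P -> mv q Q -> mv r T ->
  pushforward_natural P Q -> pushforward_natural P T -> pushforward_natural P (Q ∧ T).
Proof.
move=> mP mQ mT N1 N2; rewrite /pushforward_natural (sb_leibniz SA mP mQ mT).
have mp := @multivector_pushforward.
rewrite pushforward_wedge (sb_leibniz SM (mp _ _ mP) (mp _ _ mQ) (mp _ _ mT)).
by rewrite -N1 -N2 -!pushforward_wedge.
Qed.

Lemma natural0 p P : mv p P -> pushforward_natural P mv_zero.
Proof.
move=> mP; rewrite /pushforward_natural (sbr0 SA mP).
exact: (esym (sbr0 SM (multivector_pushforward mP))).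
Qed.

Lemma natural_fun f g : pushforward_natural (mv_fun f) (mv_fun g).
Proof.
rewrite /pushforward_natural (sb_degree0 SA (mv_funP f) (mv_funP g)) !pushforward_fun.
by rewrite (sb_degree0 SM (mv_funP f) (mv_funP g)).
Qed.

Lemma natural_sec_fun X f : sec X -> pushforward_natural (mv_sec X) (mv_fun f).
Proof.
move=> sX; rewrite /pushforward_natural sb_function// pushforward_sec !pushforward_fun.
rewrite sb_function//; exact: (anchor_smooth (lie_algebroidP A) sX).
Qed.

Lemma natural_sec X Y : sec X -> sec Y -> pushforward_natural (mv_sec X) (mv_sec Y).
Proof.
move=> sX sY; rewrite /pushforward_natural sb_sections// !pushforward_sec.
rewrite sb_sections//; last 2 first.
- exact: (anchor_smooth (lie_algebroidP A) sX).
- exact: (anchor_smooth (lie_algebroidP A) sY).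
by congr mv_sec; apply: functional_extensionality_dep => x; exact: anchor_bracket.
Qed.

Lemma natural_decomposable p P Q : mv p P -> decomposable Q ->
  (forall X, sec X -> pushforward_natural P (mv_sec X)) -> pushforward_natural P Q.
Proof.
move=> mP + NX; elim=> [|k X Y T sX sY dT NT]; first exact: natural0 mP.
have mX := multivector_sec sX; have mY := multivector_sec sY.
apply: (natural_lin k mP (multivector_wedge sX sY) (multivector_decomposable dT)) => //.
by apply: (natural_wedge mP mX mY); exact: NX.
Qed.

Lemma natural_decomposable_fun P f : decomposable P -> pushforward_natural P (mv_fun f).
Proof.
move=> dP; apply: (natural_skew (mv_funP f) (multivector_decomposable dP)).
apply: (natural_decomposable (mv_funP f) dP) => X sX.
exact: natural_skew (multivector_sec sX) (mv_funP f) (natural_sec_fun f sX).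
Qed.

Lemma natural_decomposable_sec P X : decomposable P -> sec X ->
  pushforward_natural P (mv_sec X).
Proof.
move=> dP sX; have mX := multivector_sec sX.
apply: (natural_skew mX (multivector_decomposable dP)).
by apply: (natural_decomposable mX dP) => Y sY; exact: natural_sec.
Qed.

Lemma natural_decomposable2 P Q : decomposable P -> decomposable Q ->
  pushforward_natural P Q.
Proof.
move=> dP dQ; apply: (natural_decomposable (multivector_decomposable dP) dQ).
by move=> X sX; exact: natural_decomposable_sec.
Qed.

End Naturality.
Arguments pushforward {R n M A} P x _.

(** * Contraction by the cocycle *)

Section JacobiAlgebroid.
Context {R : realType} {n : nat} {M : manifold R n} {A : jacobi_algebroid M}.
Variable S : schouten A.
Implicit Types (P Q T : mvfield A) (f g : Cinf M) (X Y Z W : forall x, A x) (x : M).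
Local Notation sec := (@smooth_section R n M A).
Local Notation mv := (@multivector R n M A).
Local Notation "P ∧ Q" := (mv_wedge P Q) (at level 40, left associativity).
Local Notation fn := (@mv_fun R n M A).
Local Notation sc := (@mv_sec R n M A).
Local Notation phi := (phi0 A).
Local Notation iphi := (mv_contract phi).

(** Bundled as a smooth function, since the axioms for brackets with functions take an element of
    [Cinf M]. *)
Definition phi_fun X : Cinf M := toCinf (fun x => phi x (X x)).

Lemma phi_funE X x : sec X -> phi_fun X x = phi x (X x).
Proof. by move=> sX; rewrite /phi_fun toCinfE//; exact: phi0_smooth. Qed.

(** The cocycle condition, in the form in which the derivation property consumes it. *)
Lemma phi_bracket X Y x : sec X -> sec Y ->
  phi x (bracket X Y x) =
  anchor_act X (phi_fun Y) x - anchor_act Y (phi_fun X) x.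
Proof.
move=> sX sY; have /eqP := phi0_closed sX sY x.
rewrite /lie_d1 subr_eq0 => /eqP <-.
have E Z : sec Z -> phi_fun Z = (fun x => phi x (Z x)) :> (M -> R).
  by move=> sZ; apply/funext => y; exact: phi_funE.
by rewrite -!E.
Qed.

Lemma contract_phi_sec X : sec X -> iphi (sc X) = fn (phi_fun X).
Proof.
move=> sX; apply: mvP => x s.
by rewrite /mv_contract /mv_sec contract_ext1 /mv_fun phi_funE.
Qed.

Lemma contract_phi_wedge X Y : sec X -> sec Y ->
  iphi (sc X ∧ sc Y) =
  mv_add (mv_scale (-1) (fn (phi_fun Y) ∧ sc X)) (fn (phi_fun X) ∧ sc Y).
Proof.
move=> sX sY; apply: mvP => x s.
rewrite /mv_contract /contract /mv_add /mv_scale !mv_wedge_funE !phi_funE//.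
by rewrite /mv_wedge wedge_ext1 /mv_sec; ring.
Qed.

Lemma contract_phi_mul f P : iphi (fn f ∧ P) = fn f ∧ iphi P.
Proof.
by apply: mvP => x s; rewrite mv_wedge_funE /mv_contract /contract mv_wedge_funE.
Qed.

Lemma sb_sec_mul Z f X : sec Z -> sec X -> forall x s,
  S (sc Z) (fn f ∧ sc X) x s =
  anchor_act Z f x * sc X x s + f x * sc (bracket Z X) x s.
Proof.
move=> sZ sX x s.
rewrite (sb_leibniz1 S (multivector_sec sZ) (mv_funP f) (multivector_sec sX)).
by rewrite sb_function// sb_sections// !wedge_ext0l.
Qed.

Lemma sb_mul_sec f X Z : sec Z -> sec X -> forall x s,
  S (fn f ∧ sc X) (sc Z) x s =
  - (anchor_act Z f x * sc X x s + f x * sc (bracket Z X) x s).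
Proof.
move=> sZ sX x s.
have mX := multivector_mul (Cinf_smooth f) (multivector_sec sX).
by rewrite (sb_skew1 S mX (multivector_sec sZ)) sb_sec_mul.
Qed.

Lemma sb_wedge_fun X Y f : sec X -> sec Y -> forall x s,
  S (sc X ∧ sc Y) (fn f) x s =
  anchor_act Y f x * sc X x s - anchor_act X f x * sc Y x s.
Proof.
move=> sX sY x s; have mX := multivector_sec sX; have mY := multivector_sec sY.
have := sb_skew2 S (multivector_wedge sX sY) (mv_funP f) s.
rewrite expr0 mul1r => <-; rewrite (sb_leibniz0 S f mX mY).
rewrite (funext (fun s' : seq (dual (A x)) => sb_fun_sec S f sX s')).
rewrite (funext (fun s' : seq (dual (A x)) => sb_fun_sec S f sY s')).
have E (g : M -> R) : (fun s' => - fn g x s') = ext0 (- g x).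
  by apply/funext => -[|a t]; rewrite /mv_fun /= ?oppr0.
by rewrite !E wedge_ext0l wedge_ext0r; ring.
Qed.

Lemma sb_mul_sec_fun f X g : sec X -> forall x s,
  S (fn f ∧ sc X) (fn g) x s = f x * fn (anchor_act X g) x s.
Proof.
move=> sX x s; have mX := multivector_sec sX.
rewrite (sb_skew1 S (multivector_mul (Cinf_smooth f) mX) (mv_funP g)).
rewrite (sb_leibniz0 S g (mv_funP f) mX).
rewrite (sb_degree0 S (mv_funP g) (mv_funP f)) wedge0l wedge_ext0l.
by rewrite sb_fun_sec//; ring.
Qed.

(* The sign is the one for P of degree 2.                                     *)
Definition contract_derivation P Q :=
  iphi (S P Q) = mv_add (mv_scale (-1) (S P (iphi Q))) (S (iphi P) Q).

(** By linearity [P] is some [X ∧ Y]. Contracting [[Z, X] ∧ Y + X ∧ [Z, Y]] produces [phi [Z, X]]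
    and [phi [Z, Y]], and [phi_bracket] turns these into the derivatives of [phi X], [phi Y] and
    [phi Z] on the right. *)
Lemma contract_derivation_sec P Z : decomposable P -> sec Z ->
  contract_derivation P (sc Z).
Proof.
move=> dP sZ; have mZ := multivector_sec sZ; rewrite /contract_derivation.
rewrite contract_phi_sec//; set f := phi_fun Z.
elim: P / dP => [|k X Y P sX sY dP IH].
  rewrite (sb0l S mZ) (sb0l S (mv_funP f)).
  rewrite (_ : iphi mv_zero = mv_zero) ?(sb0l S mZ)//.
  by apply: mvP => x s; rewrite /mv_add /mv_scale /mv_zero mulr0 addr0.
have mXY := multivector_wedge sX sY; have mP := multivector_decomposable dP.
have mc := multivector_contract (@phi0_smooth _ _ _ A).
rewrite (sb_linear_l S k mXY mP mZ) (sb_linear_l S k mXY mP (mv_funP f)).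
rewrite (_ : iphi (mv_add (mv_scale k (sc X ∧ sc Y)) P) =
  mv_add (mv_scale k (iphi (sc X ∧ sc Y))) (iphi P))//.
rewrite (sb_linear_l S k (mc _ _ mXY) (mc _ _ mP) mZ).
have IH' := congr1 (fun B : mvfield A => B _ _) IH.
apply: mvP => x s; have := IH' x s.
rewrite /mv_contract /contract /mv_add /mv_scale => ->.
suff -> : S (sc X ∧ sc Y) (sc Z) x (phi x :: s) =
    - S (sc X ∧ sc Y) (fn f) x s + S (iphi (sc X ∧ sc Y)) (sc Z) x s by ring.
have mX := multivector_sec sX; have mY := multivector_sec sY.
have := sb_skew2 S mXY mZ (phi x :: s); rewrite expr1 mulN1r.
move=> /eqP; rewrite -eqr_oppLR => /eqP <-.
rewrite (sb_leibniz1 S mZ mX mY) !sb_sections// !wedge_ext1.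
rewrite contract_phi_wedge//.
have mfX := multivector_mul (Cinf_smooth (phi_fun Y)) mX.
have mfY := multivector_mul (Cinf_smooth (phi_fun X)) mY.
rewrite (sb_linear_l S (-1) mfX mfY mZ) /mv_add /mv_scale !sb_mul_sec//.
rewrite sb_wedge_fun// !phi_bracket// !phi_funE// /mv_sec -/f; ring.
Qed.

(** Bracketing with [P] and contracting both obey signed Leibniz rules; after expansion the only
    reordering needed is that of the vectors [[P, phi W]] and [Z]. *)
Lemma contract_derivation_wedge P Z W : mv 2 P -> sec Z -> sec W ->
  contract_derivation P (sc Z) -> contract_derivation P (sc W) ->
  contract_derivation P (sc Z ∧ sc W).
Proof.
rewrite /contract_derivation => mP sZ sW; rewrite !contract_phi_sec// => KZ KW.
have mZ := multivector_sec sZ; have mW := multivector_sec sW.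
have mcP := multivector_contract (@phi0_smooth _ _ _ A) mP.
have mfZ := multivector_mul (Cinf_smooth (phi_fun W)) mZ.
have mfW := multivector_mul (Cinf_smooth (phi_fun Z)) mW.
have [hPZ _] := sb_degree S mP mZ isT.
have [hPf _] := sb_degree S mP (mv_funP (phi_fun W)) isT.
rewrite (contract_phi_wedge sZ sW) (sb_linear S (-1) mP mfZ mfW).
apply: mvP => x s; rewrite /mv_add /mv_scale (sb_leibniz1 S mcP mZ mW).
rewrite [LHS]/mv_contract /contract (sb_leibniz2 S mP mZ mW).
have := contract_wedge (sc W x) (phi x) s (hPZ x).
have := contract_wedge (S P (sc W) x) (phi x) s (homogeneous_ext1 (Z x)).
rewrite /contract -!/(contract (phi x) _) => -> ->.
have KZx : contract (phi x) (S P (sc Z) x) = iphi (S P (sc Z)) x by [].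
have KWx : contract (phi x) (S P (sc W) x) = iphi (S P (sc W)) x by [].
rewrite KZx KWx KZ KW !contract_ext1 wedge_ext0l wedge_ext0r.
rewrite /mv_add /mv_scale wedge_linl wedge_linr.
rewrite (sb_leibniz2 S mP (mv_funP _) mZ) (sb_leibniz2 S mP (mv_funP _) mW).
rewrite !wedge_ext0l !phi_funE//.
rewrite (homogeneous1_wedgeC s (hPf x) (homogeneous_ext1 (Z x))) /mv_sec; ring.
Qed.

Lemma contract_derivation_decomposable P Q :
  decomposable P -> decomposable Q -> contract_derivation P Q.
Proof.
move=> dP; have mP := multivector_decomposable dP.
have mc := multivector_contract (@phi0_smooth _ _ _ A); have mcP := mc _ _ mP.
elim=> [|k X Y Q' sX sY dQ IH].
  rewrite /contract_derivation (sbr0 S mP) (sbr0 S mcP).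
  by apply: mvP => x s; rewrite /mv_add /mv_scale /mv_zero mulr0 addr0.
have mXY := multivector_wedge sX sY; have mQ := multivector_decomposable dQ.
have KX := contract_derivation_sec dP sX; have KY := contract_derivation_sec dP sY.
have KXY := contract_derivation_wedge mP sX sY KX KY.
rewrite /contract_derivation (sb_linear S k mP mXY mQ).
rewrite (sb_linear S k mcP mXY mQ).
rewrite (_ : iphi (mv_add (mv_scale k (sc X ∧ sc Y)) Q') =
  mv_add (mv_scale k (iphi (sc X ∧ sc Y))) (iphi Q'))//.
rewrite (sb_linear S k mP (mc _ _ mXY) (mc _ _ mQ)).
rewrite (_ : iphi (mv_add (mv_scale k _) _) =
  mv_add (mv_scale k (iphi (S P (sc X ∧ sc Y)))) (iphi (S P Q')))//.
by rewrite KXY IH; apply: mvP => x s; rewrite /mv_add /mv_scale; ring.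
Qed.

(** The derivation property against a function, whose own contraction is zero: for [X ∧ Y] both
    sides are [phi(X) Yg - phi(Y) Xg]. *)
Lemma contract_sb_fun P g : decomposable P ->
  iphi (S P (fn g)) = S (iphi P) (fn g).
Proof.
move=> dP; have mc := multivector_contract (@phi0_smooth _ _ _ A).
have mg : mv 0 (fn g) := mv_funP g.
elim: P / dP => [|k X Y P sX sY dP IH].
  by rewrite (sb0l S mg) (_ : iphi mv_zero = mv_zero) ?(sb0l S mg).
have mXY := multivector_wedge sX sY; have mP := multivector_decomposable dP.
have mX := multivector_sec sX; have mY := multivector_sec sY.
rewrite (sb_linear_l S k mXY mP mg).
rewrite (_ : iphi (mv_add (mv_scale k (sc X ∧ sc Y)) P) =
  mv_add (mv_scale k (iphi (sc X ∧ sc Y))) (iphi P))//.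
rewrite (sb_linear_l S k (mc _ _ mXY) (mc _ _ mP) mg) -IH contract_phi_wedge//.
have mfX := multivector_mul (Cinf_smooth (phi_fun Y)) mX.
have mfY := multivector_mul (Cinf_smooth (phi_fun X)) mY.
rewrite (sb_linear_l S (-1) mfX mfY mg).
apply: mvP => x s; rewrite /mv_contract /contract /mv_add /mv_scale.
rewrite sb_wedge_fun// !sb_mul_sec_fun// !phi_funE// /mv_sec /mv_fun.
by congr (_ * _ + _); case: s => [|a s] /=; ring.
Qed.

(** By [sb_mul1] the left side is [g^2 [v, P]]. The identity arises by contracting [[D, D] = 2
    [D, g] ∧ P + g^2 [P, P]] with [phi], for [D = g P], and dividing by 2. *)
Lemma bracket_contract_bivector P g :
  mv 2 P -> decomposable (fn g ∧ P) ->
  S P P = mv_scale (-2) (iphi P ∧ P) -> forall x s,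
  S (iphi (fn g ∧ P)) (fn g ∧ P) x s
    - wedge (S (iphi (fn g ∧ P)) (fn g) x) (P x) s
    + wedge (S (fn g ∧ P) (fn g) x) (iphi P x) s = 0.
Proof.
set D := fn g ∧ P => mP dD PP x s; have mD := multivector_decomposable dD.
have mc := multivector_contract (@phi0_smooth _ _ _ A).
have [hDg _] := sb_degree S mD (mv_funP g) isT.
have hcP := (mc _ _ mP).1 x.
have skew := sb_skew2 S mD (mc _ _ mD) s.
have KDD : S D D x (phi x :: s) = 2 * S (iphi D) D x s.
  transitivity (iphi (S D D) x s) => //.
  rewrite (contract_derivation_decomposable dD dD) /mv_add /mv_scale.
  by move: skew; rewrite expr1 => ->; ring.
have KDg : wedge (S D (fn g) x) (P x) (phi x :: s) =
    wedge (S (iphi D) (fn g) x) (P x) s - wedge (S D (fn g) x) (iphi P x) s.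
  have := contract_wedge (P x) (phi x) s (hDg x).
  rewrite expr1 mulN1r -contract_sb_fun//; exact.
(* The contraction of [v ∧ P] vanishes: [v] contracts to zero because [P] is alternating, and
   [v ∧ v = 0]. *)
have KPP : S P P x (phi x :: s) = 0.
  rewrite PP /mv_scale /mv_wedge.
  have := contract_wedge (P x) (phi x) s hcP.
  rewrite (_ : contract (phi x) (iphi P x) = fun=> 0); last first.
    by apply/funext => t; have [_ _ Pa] := mP.1 x; exact: (Pa [::] [::] t).
  rewrite wedge0l (_ : contract (phi x) (P x) = iphi P x)//.
  rewrite homogeneous1_wedgeP// mulr0 addr0 => E.
  by transitivity (- 2 * 0 : R); [congr (_ * _)|rewrite mulr0].
have := sb_mul2 S g mP (phi x :: s); rewrite -/D KDD KDg KPP => E.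
apply: (@mulfI _ (2 : R)); first by rewrite pnatr_eq0.
by rewrite mulr0 mulrDr mulrBr E; ring.
Qed.

End JacobiAlgebroid.

Section Differential.
Context {R : realType} {n : nat} {M : manifold R n}.

Lemma differential_linear (f : Cinf M) (x : M) :
  (fun D : tangent x => D f) \in is_linear (V := tangent x).
Proof. by apply/asboolP. Qed.

Definition differential (f : Cinf M) (x : M) : dual (tangent x) :=
  MkDual (differential_linear f x).

End Differential.

(** * Push-forward of a Jacobi bivector *)

Section Pushforward.
Context {R : realType} {n : nat} {M : manifold R n} {A : jacobi_algebroid M}.
Variables (SA : schouten A) (SM : schouten (tangent_algebroid M)).
Implicit Types (P Q T : mvfield A) (f g : Cinf M) (X Y : forall x, A x) (x : M).
Local Notation sec := (@smooth_section R n M A).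
Local Notation mv := (@multivector R n M A).
Local Notation "P ∧ Q" := (mv_wedge P Q) (at level 40, left associativity).
Local Notation rho := (@pushforward R n M A).
Local Notation phi := (phi0 A).
Local Notation iphi := (mv_contract phi).
Local Notation natural := (pushforward_natural SA SM).

(** The contraction of a decomposable bivector is a sum of functions times sections, so naturality
    against functions and sections suffices. *)
Lemma natural_contract p P Q : mv p P -> decomposable Q ->
  (forall X, sec X -> natural P (mv_sec X)) ->
  (forall f, natural P (mv_fun f)) -> natural P (iphi Q).
Proof.
move=> mP + NX Nf; have mc := multivector_contract (@phi0_smooth _ _ _ A).
elim=> [|k X Y T sX sY dT IH]; first exact: (natural0 _ _ mP).
have mXY := multivector_wedge sX sY; have mT := multivector_decomposable dT.
apply: (natural_lin k mP (mc _ _ mXY) (mc _ _ mT) _ IH).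
have mX := multivector_sec sX; have mY := multivector_sec sY.
rewrite contract_phi_wedge//.
have mfX := multivector_mul (Cinf_smooth (phi_fun Y)) mX.
have mfY := multivector_mul (Cinf_smooth (phi_fun X)) mY.
apply: (natural_lin (-1) mP mfX mfY).
- exact: (natural_wedge mP (mv_funP _) mX (Nf _) (NX _ sX)).
- exact: (natural_wedge mP (mv_funP _) mY (Nf _) (NX _ sY)).
Qed.

Lemma jacobi_structure_pushforward P (E : forall x : M, tangent x) :
  mv 2 P -> SA P P = mv_scale (- 2) (iphi P ∧ P) ->
  (forall x, exists2 g : Cinf M, g x <> 0 & decomposable (mv_fun g ∧ P)) ->
  @mv_sec R n M (tangent_algebroid M) E = rho (iphi P) ->
  jacobi_structure SM (rho P) E.
Proof.
move=> mP PP loc EP; have mrP := multivector_pushforward mP.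
have mc := multivector_contract (@phi0_smooth _ _ _ A).
have mrE : multivector 1 (@mv_sec R n M (tangent_algebroid M) E).
  by rewrite EP; exact: multivector_pushforward (mc _ _ mP).
have rhoE Q x s : rho Q x s = Q x (map (transpose (anchor A x)) s) by [].
have rho_wedge Q T x s : wedge (rho Q x) (rho T x) s =
    wedge (Q x) (T x) (map (transpose (anchor A x)) s).
  by rewrite /pushforward -ext_map_wedge.
split=> //.
(* Evaluating the multivector field of [E] on the smooth form [df] gives [E f]. *)
- move=> f; pose df : oneform (tangent_algebroid M) := differential f.
  by have := mrE.2 (fun=> df) (fun _ V vV => vV f).
- rewrite EP; apply: mvP => x s; have [g gx dD] := loc x.
  have := sb_mul2 SM g mrP s; have := sb_mul2 SA g mP (map (transpose (anchor A x)) s).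
  have := natural_decomposable2 SA SM dD dD.
  have := natural_decomposable_fun SA SM g dD.
  rewrite /pushforward_natural !pushforward_wedge !pushforward_fun => <- <-.
  (* The expansions of [[D, D]] on [A] and on [M] share the term with [[D, g]]; it cancels, and then
     both factors [g x] do. *)
  rewrite !rho_wedge -!rhoE => -> /addrI /(mulfI (introN eqP gx)).
  move=> /(mulfI (introN eqP gx)) <-.
  by rewrite rhoE PP /mv_scale /mv_wedge rho_wedge.
- apply: mvP => x s; have [g gx dD] := loc x.
  apply: (mulfI (introN eqP gx)); apply: (mulfI (introN eqP gx)).
  rewrite EP in mrE *; rewrite (sb_mul1 SM g mrE mrP).
  have mD := multivector_decomposable dD.
  have NDg := natural_decomposable_fun SA SM g dD.
  have NDD : natural (iphi (mv_fun g ∧ P)) (mv_fun g ∧ P).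
    apply: (natural_skew mD (mc _ _ mD)).
    apply: (natural_contract mD dD) => [X sX|f].
      exact: natural_decomposable_sec.
    exact: natural_decomposable_fun.
  have Ncg : natural (iphi (mv_fun g ∧ P)) (mv_fun g).
    apply: (natural_skew (mv_funP g) (mc _ _ mD)).
    apply: (natural_contract (mv_funP g) dD) => [X sX|f].
      apply: (natural_skew (multivector_sec sX) (mv_funP g)).
      exact: natural_sec_fun.
    exact: natural_fun.
  (* The three naturality facts identify the right side of [sb_mul1] on [M] with the push-forward of
     this vanishing expression. *)
  have := bracket_contract_bivector mP dD PP (map (transpose (anchor A x)) s).
  move: NDg NDD Ncg; rewrite /pushforward_natural contract_phi_mul.
  rewrite !pushforward_wedge !pushforward_fun => <- <- <-.
  by rewrite !rho_wedge -!rhoE => ->; rewrite /mv_zero !mulr0.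
Qed.

End Pushforward.

(** * Bump functions *)

Section FlatFunction.
Context {R : realType}.
Implicit Types (k : nat) (t : R).

(* The span of these functions is stable under differentiation.               *)
Definition flat k t : R := if 0 < t then t^-1 ^+ k * expR (- t^-1) else 0.

(** For [t > 0] this is [exp s >= s^(k+2) / (k+2)!] at [s = 1/t]. The quadratic bound makes the
    difference quotient at 0 tend to 0. *)
Lemma flat_le k t : 0 <= flat k t <= k.+2`!%:R * t ^+ 2.
Proof.
rewrite /flat; case: ifPn => [t0|_]; last first.
  by rewrite lexx mulr_ge0 ?ler0n ?sqr_ge0.
have tV : 0 <= t^-1 by rewrite invr_ge0 ltW.
rewrite mulr_ge0 ?expR_ge0 ?exprn_ge0//= expRN.
rewrite ler_pdivrMr ?expR_gt0//.
have := expR_ge1Dxn k.+1 tV; set e := expR _ => H.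
have {}H : t^-1 ^+ k.+2 / k.+2`!%:R <= e by rewrite (le_trans _ H)// lerDr ler01.
have f0 : 0 < k.+2`!%:R * t ^+ 2 :> R.
  by rewrite mulr_gt0 ?exprn_gt0// ltr0n fact_gt0.
rewrite -ler_pdivrMl//; apply: le_trans H.
by rewrite invfM -exprVn !exprS expr0 le_eqVlt; apply/orP; left; apply/eqP; ring.
Qed.

Lemma is_derive_flat k t :
  is_derive t 1 (flat k) (flat k.+2 t - k%:R * flat k.+1 t).
Proof.
have [t0|t0|t0] := ltgtP 0 t.
- have tn : t != 0 by rewrite gt_eqF.
  pose F : R -> R := (fun u : R => u^-1) ^+ k * (expR \o (- (fun u : R => u^-1))).
  have FE u : F u = u^-1 ^+ k * expR (- u^-1) by rewrite /F fctE exprfctE.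
  apply: (@near_eq_is_derive _ _ _ F).
    near=> u; have u0 : 0 < u by near: u; exact: lt_nbhsr.
    by rewrite FE /flat u0.
  have dV : is_derive t 1 (fun u : R => u^-1) (- t ^- 2 *: 1).
    exact: (@is_deriveV _ id).
  have dE : is_derive t 1 (expR \o (- (fun u : R => u^-1)))
      (expR (- t^-1) * - (- t ^- 2 *: 1)).
    exact: is_derive1_comp.
  have := is_deriveM (is_deriveX k dV) dE; rewrite -/F => dF.
  apply: is_derive_eq dF _; rewrite /flat t0.
  rewrite exprfctE /comp /= /GRing.scale /= !mulr1 opprK.
  rewrite [expR ((- _) t)](_ : _ = expR (- t^-1))// -exprVn.
  by case: k {F FE dE} => [|k] /=; rewrite !exprS ?expr0; ring.
- have -> : flat k.+2 t - k%:R * flat k.+1 t = 0.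
    by rewrite /flat ltNge (ltW t0) /= mulr0 subrr.
  apply: (@near_eq_is_derive _ _ _ (cst 0)).
  near=> u; have u0 : u < 0 by near: u; exact: lt_nbhsl.
  by rewrite /flat ltNge (ltW u0).
- rewrite -t0; have -> : flat k.+2 0 - k%:R * flat k.+1 0 = 0 :> R.
    by rewrite /flat ltxx mulr0 subrr.
  have q0 : (fun h : R => h^-1 *: (flat k (h *: 1 + 0) - flat k 0)) @ 0^' --> (0 : R).
    apply/cvgr0Pnorm_le => e e0; pose C : R := k.+2`!%:R.
    have C0 : 0 < C by rewrite ltr0n fact_gt0.
    near=> h.
    have hn : h != 0 by near: h; exact: nbhs_dnbhs_neq.
    have hC : `|h| <= e / C.
      near: h; apply: (@cvgr_norm_le _ _ _ _ _ id 0).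
        exact: nbhs_dnbhs.
      by rewrite normr0 divr_gt0.
    have /andP[f0 fC] := flat_le k h.
    rewrite {2}/flat ltxx subr0 addr0 [h *: 1]mulr1 normrZ normfV.
    rewrite ler_pdivrMl ?normr_gt0// (ger0_norm f0) (le_trans fC)//.
    rewrite -/C -(real_normK (num_real h)) expr2 mulrCA ler_wpM2l//.
    by rewrite mulrC -ler_pdivlMr.
  apply: DeriveDef; first by apply/cvg_ex; exists 0.
  exact: cvg_lim q0.
Unshelve. all: by end_near. Qed.

End FlatFunction.

Section SmoothComposition.
Context {R : realType} {n : nat}.
Implicit Types (V : set 'rV[R]_n) (F G s : 'rV[R]_n -> R) (u v : 'rV[R]_n).
Local Notation e_ i := (delta_mx 0 i : 'rV[R]_n).

Lemma is_derive_lineP F u v (d : R) :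
  is_derive u v F d <-> is_derive (0 : R) (1 : R) (fun h : R => F (h *: v + u)) d.
Proof.
have E : 'D_v F u = 'D_(1 : R) (fun h : R => F (h *: v + u)) (0 : R).
  rewrite /derive; set g1 := fun h => h^-1 *: _; set g2 := fun h => h^-1 *: _.
  suff -> : g1 = g2 by [].
  by rewrite funeqE /g1 /g2 => h /=; rewrite addr0 scale0r add0r [_%:A]mulr1.
split=> [[dF <-]|[dF <-]]; apply: DeriveDef; rewrite ?E//.
- exact: (derivable1P F u v).1 dF.
- exact: (derivable1P F u v).2 dF.
Qed.

(** Restriction to the line through [u] in direction [v] reduces this to the chain rule in one
    variable. *)
Lemma is_derive_comp_real (h : R -> R) F u v d :
  derivable F u v -> is_derive (F u) (1 : R) h d ->
  is_derive u v (h \o F) (d * 'D_v F u).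
Proof.
move=> /derivableP/is_derive_lineP dF dh; apply/is_derive_lineP.
by apply: is_derive1_comp; rewrite /= scale0r add0r.
Qed.

Lemma smooth_Rn_derive V F i :
  smooth_Rn V F -> smooth_Rn V (fun u => 'D_(e_ i) F u).
Proof.
move=> sF t u Vu; have := sF (rcons t i) u Vu.
by rewrite /partials -cats1 foldr_cat.
Qed.

(** A class containing [flat 0 \o s] and stable under partial derivatives. [FlatExt] is there
    because the derivative formulas hold on [V] only. *)
Inductive flat_comp V s : ('rV[R]_n -> R) -> Prop :=
| FlatTerm k G : smooth_Rn V G -> flat_comp V s (fun u => flat k (s u) * G u)
| FlatAdd F G : flat_comp V s F -> flat_comp V s G -> flat_comp V s (F \+ G)
| FlatExt F G : {in V, F =1 G} -> flat_comp V s F -> flat_comp V s G.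

Lemma near_eq_open V F G u : open V -> V u -> {in V, F =1 G} ->
  \forall v \near u, F v = G v.
Proof.
by move=> oV Vu FG; near=> v; apply: FG; rewrite inE; near: v;
   exact: open_nbhs_nbhs.
Unshelve. all: by end_near. Qed.

Lemma flat_comp_derive V s F : open V -> smooth_Rn V s -> flat_comp V s F ->
  (forall u, V u -> {for u, continuous F} /\ forall i, derivable F u (e_ i)) /\
  forall i, flat_comp V s (fun u => 'D_(e_ i) F u).
Proof.
move=> oV ss; elim=> {F} [k G sG|F G _ [gF dF] _ [gG dG]|F G FG _ [gF dF]].
- have ds u i : V u -> is_derive u (e_ i) (flat k \o s)
      ((flat k.+2 (s u) - k%:R * flat k.+1 (s u)) * 'D_(e_ i) s u).
    move=> Vu; apply: is_derive_comp_real; last exact: is_derive_flat.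
    exact: (ss [::] u Vu).2.
  split=> [u Vu|i].
    have [cG dG] := sG [::] u Vu; split=> [|i].
      apply: cvgM cG; apply: continuous_comp; first exact: (ss [::] u Vu).1.
      apply: differentiable_continuous; apply/derivable1_diffP.
      exact: (ex_derive (is_derive := is_derive_flat k (s u))).
    by have [df _] := ds u i Vu; exact: derivableM df (dG i).
  have sk (c : R) := smooth_RnM oV
    (smooth_RnM oV (@smooth_Rn_cst _ _ V c) (smooth_Rn_derive i ss)) sG.
  apply: FlatExt (FlatAdd (FlatTerm s k.+2 (sk 1)) (FlatAdd
    (FlatTerm s k.+1 (sk (- k%:R))) (FlatTerm s k (smooth_Rn_derive i sG)))) => u.
  rewrite inE => Vu /=.
  have [dfl E] := ds u i Vu; rewrite (deriveM dfl ((sG [::] u Vu).2 i)) E.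
  by rewrite /= /GRing.scale /= /cst; ring.
- split=> [u Vu|i].
    have [cF dF'] := gF u Vu; have [cG dG'] := gG u Vu.
    by split=> [|i]; [exact: cvgD cF cG|exact: derivableD (dF' i) (dG' i)].
  apply: FlatExt (FlatAdd (dF i) (dG i)) => u; rewrite inE => Vu /=.
  by rewrite deriveD//; [exact: (gF u Vu).2|exact: (gG u Vu).2].
- split=> [u Vu|i].
    have [cF dF'] := gF u Vu; have E := near_eq_open oV Vu FG.
    split=> [|i]; last exact: near_eq_derivable (dF' i).
    rewrite /prop_for /continuous_at -FG ?inE//.
    exact: (cvg_trans (near_eq_cvg (F := nbhs u) E) cF).
  apply: FlatExt (dF i) => u; rewrite inE => Vu.
  by apply: near_eq_derive; exact: near_eq_open FG.
Qed.

Lemma smooth_flat V s : open V -> smooth_Rn V s -> smooth_Rn V (flat 0 \o s).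
Proof.
move=> oV ss.
have H t : flat_comp V s (partials t (flat 0 \o s)).
  elim: t => [|i t IH]; last exact: (flat_comp_derive oV ss IH).2.
  apply: FlatExt (FlatTerm s 0 (@smooth_Rn_cst _ _ V 1)) => u _.
  by rewrite /cst mulr1.
by move=> t u Vu; exact: (flat_comp_derive oV ss (H t)).1.
Qed.

Lemma smooth_Rn_sum V (I : Type) (r : seq I) (F : I -> 'rV[R]_n -> R) : open V ->
  (forall i, smooth_Rn V (F i)) -> smooth_Rn V (fun u => \sum_(i <- r) F i u).
Proof.
move=> oV sF; elim: r => [|i r IH].
  apply: (smooth_Rn_ext oV _ (@smooth_Rn_cst _ _ V 0)) => u _.
  by rewrite big_nil.
apply: (smooth_Rn_ext oV _ (smooth_RnD oV (sF i) IH)) => u _.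
by rewrite big_cons.
Qed.

End SmoothComposition.

Section Bump.
Context {R : realType} {n : nat} {M : manifold R n}.
Implicit Types (U W K : set M) (f a : M -> R) (x y : M).

Lemma smooth_on_local W f :
  (forall x, W x -> exists2 U, U x & smooth_on U f) -> smooth_on W f.
Proof.
move=> H c ac t _ [x [Wx cx] <-]; have [U Ux sf] := H x Wx.
by apply: sf => //; exists x.
Qed.

Lemma smooth_on_ext U f g : open U -> {in U, f =1 g} ->
  smooth_on U f -> smooth_on U g.
Proof.
move=> oU fg sf c ac; apply: smooth_Rn_ext (sf c ac); first exact: chart_open.
by move=> _ /set_mem[y [Uy cy] <-] /=; rewrite cmapK// fg// inE.
Qed.

(** [W] is covered by [U], where both factors are smooth, and by the open complement of [K], where
    the product is zero; [a] is arbitrary outside [U]. *)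
Lemma smooth_on_mul_support U W K f a :
  open U -> open W -> closed K -> K `<=` U -> (forall x, ~ K x -> f x = 0) ->
  smooth_on setT f -> smooth_on (U `&` W) a ->
  smooth_on W (fun x => f x * a x).
Proof.
move=> oU oW cK KU f0 sf sa; apply: smooth_on_local => x Wx.
have [Kx|nKx] := pselect (K x).
  exists (U `&` W); first by split => //; exact: KU.
  apply: smooth_onM sa; first exact: openI.
  by apply: smooth_on_sub sf.
exists (~` K) => //.
apply: (@smooth_on_ext _ (cst 0)); first exact: closed_openC.
  by move=> y; rewrite inE => nKy; rewrite f0// mul0r.
exact: (@smooth_on_cst R n M).
Qed.

(** In a chart, [exp (-1/s)] with [s] equal to [r^2] minus the squared Euclidean distance to the
    image of [x], extended by zero. [K] is the preimage of a closed cube: compact, hence closed as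
    [M] is Hausdorff. *)
Lemma exists_bump U x : open U -> U x ->
  exists f : Cinf M, exists K,
    [/\ closed K, K `<=` U, forall y, ~ K y -> f y = 0 & f x <> 0].
Proof.
move=> oU Ux; have [c ac cx] := atlas_cover x.
pose a := cmap c x.
have : nbhs a (cmap c @` (U `&` cdom c)).
  by apply: open_nbhs_nbhs; split; [exact: chart_open|exists x].
move=> /nbhs_ballP[e /= e0 eU].
(* Half the radius, so that the closed cube lies in the open ball of the sup norm. *)
pose r := e / 2; have r0 : 0 < r by rewrite divr_gt0.
pose B : set 'rV[R]_n := [set u | forall i, `[a 0 i - r, a 0 i + r]%classic (u 0 i)].
have BU : B `<=` cmap c @` (U `&` cdom c).
  move=> u Bu; apply: eU; split => // i j.
  rewrite (ord1 i) /ball /= /ball /=.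
  have := Bu j; rewrite /= in_itv /= => /andP[u1 u2].
  apply: (@le_lt_trans _ _ r); last by rewrite /r ltr_pdivrMr// ltr_pMr// ltr1n.
  by rewrite ler_distl; apply/andP; split; lra.
have cB : compact B.
  apply: (@rV_compact _ _ (fun i => `[a 0 i - r, a 0 i + r]%classic)) => i.
  exact: segment_compact.
pose K := cinv c @` B.
have cK : closed K.
  apply: compact_closed; first exact: mhausdorff.
  apply: continuous_compact cB; apply: continuous_in_subspaceT => u /set_mem Bu.
  by have [y [_ cy] <-] := BU u Bu; exact: cinv_cont.
have KU : K `<=` U `&` cdom c.
  by move=> _ [u Bu <-]; have [y [Uy cy] <-] := BU u Bu; rewrite cmapK.
(* If [s y > 0], each coordinate differs from that of [x] by at most [r], so [y] lies in [K]. *)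
pose s y := r ^+ 2 - \sum_i (cmap c y 0 i - a 0 i) ^+ 2.
pose f y := if y \in cdom c then flat 0 (s y) else 0.
have f0 y : ~ K y -> f y = 0.
  move=> nKy; rewrite /f; case: ifPn => // /set_mem cy.
  rewrite /flat; case: ifPn => // sy; exfalso; apply: nKy.
  exists (cmap c y); last exact: cmapK.
  move=> i; rewrite /= in_itv /= -ler_distl.
  rewrite -(@ler_pXn2r _ 2)// ?nnegrE ?normr_ge0 ?(ltW r0)// real_normK ?num_real//.
  have : \sum_i (cmap c y 0 i - a 0 i) ^+ 2 <= r ^+ 2 by rewrite -subr_ge0 ltW.
  apply: le_trans; rewrite (bigD1 i)//= lerDl.
  by apply: sumr_ge0 => j _; exact: sqr_ge0.
have sf : smooth_on setT f.
  (* Outside the chart domain, the complement of [K] is a neighbourhood on which [f] vanishes;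
     inside, the transition maps give smoothness in any other chart. *)
  apply: smooth_on_local => y _; have [cy|ncy] := pselect (cdom c y); last first.
    exists (~` K); first by move=> /KU[].
    apply: (@smooth_on_ext _ (cst 0)); first exact: closed_openC.
      by move=> z; rewrite inE => nKz; rewrite f0.
    exact: (@smooth_on_cst R n M).
  exists (cdom c) => // c' ac'.
  have oV := chart_open (c := c') (cdom_open c).
  pose T k u := cmap c (cinv c' u) 0 k - a 0 k.
  have sT k : smooth_Rn (cmap c' @` (cdom c `&` cdom c')) (T k).
    apply: (smooth_RnD oV _ (@smooth_Rn_cst _ _ _ (- a 0 k))).
    by rewrite setIC; exact: atlas_smooth.
  have sS : smooth_Rn (cmap c' @` (cdom c `&` cdom c'))
      (fun u => r ^+ 2 + -1 * \sum_k T k u * T k u).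
    apply: smooth_RnD (smooth_Rn_cst _) _ => //.
    apply: smooth_RnM (smooth_Rn_cst _) _ => //.
    by apply: smooth_Rn_sum => // k; exact: smooth_RnM.
  apply: smooth_Rn_ext (smooth_flat oV sS) => // _ /set_mem[z [cz c'z] <-] /=.
  rewrite /f cmapK// mem_set// /s mulN1r; congr (flat 0 (_ - _)).
  by apply: eq_bigr => k _; rewrite /T cmapK// expr2.
exists (toCinf f), K; rewrite toCinfE//; split => //.
  by move=> y /KU[].
rewrite /f mem_set// /s big1 => [|i _]; last by rewrite subrr expr0n.
apply/eqP; rewrite gt_eqF// /flat subr0 exprn_gt0// expr0 mul1r; exact: expR_gt0.
Qed.

End Bump.

(** * Local decomposition of bivectors *)

Section DualSums.
Context {R : realType} {V : lmodType R}.
Implicit Types (d : dual V) (v : V).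

Lemma dual_sum (I : Type) (r : seq I) d (c : I -> R) (v : I -> V) :
  d (\sum_(i <- r) c i *: v i) = \sum_(i <- r) c i * d (v i).
Proof.
elim: r => [|i r IH]; first by rewrite !big_nil dual0.
by rewrite !big_cons dualP IH.
Qed.

Lemma sum_dualE (I : Type) (r : seq I) (c : I -> R) (d : I -> dual V) v :
  (\sum_(i <- r) c i *: d i) v = \sum_(i <- r) c i * d i v.
Proof.
elim: r => [|i r IH]; first by rewrite !big_nil.
by rewrite !big_cons -IH.
Qed.

Lemma homogeneous_sum p (P : ext V) (I : Type) (r : seq I) (c : I -> R)
    (d : I -> dual V) s1 s2 : homogeneous p P ->
  P (s1 ++ (\sum_(i <- r) c i *: d i) :: s2) =
  \sum_(i <- r) c i * P (s1 ++ d i :: s2).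
Proof.
move=> [_ Pl _]; elim: r => [|i r IH]; last by rewrite !big_cons Pl IH.
rewrite !big_nil; have := Pl s1 s2 (-1) 0 0.
by rewrite scaler0 addr0 mulN1r addNr.
Qed.

Lemma homogeneous2_skew (P : ext V) a b :
  homogeneous 2 P -> P [:: b; a] = - P [:: a; b].
Proof.
move=> hP; have [_ Pl Pa] := hP; apply/eqP; rewrite -addr_eq0 addrC.
have := Pa [::] [::] [::] (a + b).
have E c : P [:: a + b; c] = P [:: a; c] + P [:: b; c].
  by have := Pl [::] [:: c] 1 a b; rewrite scale1r mul1r.
have E' c : P [:: c; a + b] = P [:: c; a] + P [:: c; b].
  by have := Pl [:: c] [::] 1 a b; rewrite scale1r mul1r.
rewrite /= E !E' (Pa [::] [::] [::] a) (Pa [::] [::] [::] b).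
by rewrite add0r addr0 => /eqP.
Qed.

End DualSums.

Section Localization.
Context {R : realType} {n : nat} {M : manifold R n} (E : vector_bundle M).
Implicit Types (e : local_frame (vfiber E) (vrank E)) (x : M).
Local Notation r := (vrank E).

Lemma frame_coord_inj e x (a b : 'I_r -> R) : fdom e x ->
  \sum_i a i *: fvec e i x = \sum_i b i *: fvec e i x -> a =1 b.
Proof.
move=> ex ab i.
have [c [_ cU]] := fvec_basis ex (\sum_i a i *: fvec e i x).
have Ea : c = \row_i a i by apply: cU; apply: eq_bigr => j _; rewrite mxE.
have Eb : c = \row_i b i.
  by rewrite ab in cU; apply: cU; apply: eq_bigr => j _; rewrite mxE.
by have := congr1 (fun u : 'rV_r => u 0 i) (etrans (esym Ea) Eb); rewrite !mxE.
Qed.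

Lemma coframe_at e x : fdom e x ->
  exists d : 'I_r -> dual (vfiber E x), forall v, v = \sum_i d i v *: fvec e i x.
Proof.
move=> ex; have /choice[a aE] : forall v : vfiber E x,
    exists a : 'I_r -> R, v = \sum_i a i *: fvec e i x.
  by move=> v; have [c [cE _]] := fvec_basis ex v; exists (c 0).
have lin i : (fun v => a v i) \in is_linear (V := vfiber E x).
  apply/asboolP => k u v.
  apply: (frame_coord_inj (b := fun i => k * a u i + a v i) ex).
  rewrite -aE [in LHS](aE u) [in LHS](aE v) scaler_sumr -big_split /=.
  by apply: eq_bigr => j _; rewrite scalerDl scalerA.
by exists (fun i => MkDual (lin i)).
Qed.

Lemma exists_coframe e : exists d : 'I_r -> forall x, dual (vfiber E x),
  forall x, fdom e x -> forall v, v = \sum_i d i x v *: fvec e i x.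
Proof.
have H x : exists d : 'I_r -> dual (vfiber E x),
    fdom e x -> forall v, v = \sum_i d i v *: fvec e i x.
  have [/coframe_at[d dE]|nex] := pselect (fdom e x); first by exists d.
  by exists (fun=> 0).
exists (fun i x => projT1 (cid (H x)) i) => x ex v.
exact: (projT2 (cid (H x))).
Qed.

Lemma coframe_dual e x (d : 'I_r -> dual (vfiber E x)) (b : dual (vfiber E x)) :
  (forall v, v = \sum_i d i v *: fvec e i x) ->
  b = \sum_i b (fvec e i x) *: d i.
Proof.
move=> dE; apply/val_inj/funext => v.
have -> : val b v = b v by [].
rewrite (dE v) dual_sum; apply: etrans (esym (sum_dualE _ _ _ _)).
by rewrite -(dE v); apply: eq_bigr => i _; rewrite mulrC.
Qed.

(** [sharp] is a choice with default 0, so a representing vector must be exhibited: finite rank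
    gives the sum of the [P [:: a; d i] *: fvec e i x]. *)
Lemma contract_sharp x (P : ext (vfiber E x)) a :
  homogeneous 2 P -> contract a P = ext1 (sharp P a).
Proof.
move=> hP; have [e fe ex] := frames_cover E x; have [d dE] := coframe_at ex.
have H : forall b : dual (vfiber E x), b (sharp P a) = P [:: a; b].
  apply: (@xgetPex _ 0 (fun v => forall b : dual (vfiber E x), b v = P [:: a; b])).
  exists (\sum_i P [:: a; d i] *: fvec e i x) => b.
  rewrite dual_sum [in RHS](coframe_dual b dE).
  have := homogeneous_sum (index_enum 'I_r) (fun i => b (fvec e i x)) d [:: a] [::] hP.
  by move=> /= ->; apply: eq_bigr => i _; rewrite mulrC.
have [P0 _ _] := hP; apply/funext => -[|b [|c s]]; rewrite /contract /=.
- exact: P0.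
- by rewrite H.
- exact: P0.
Qed.

End Localization.

Lemma decomposable_sum (R : realType) (n : nat) (M : manifold R n)
    (L : algebroid_data M) (I : Type) (r : seq I) (k : R)
    (X Y : I -> forall x, L x) :
  (forall i, smooth_section (X i)) -> (forall i, smooth_section (Y i)) ->
  decomposable (L := L)
    (fun x s => \sum_(i <- r) k * wedge (ext1 (X i x)) (ext1 (Y i x)) s).
Proof.
move=> sX sY; elim: r => [|i r IH].
  have := @decomposable0 R n M L; congr decomposable.
  by apply: mvP => x s; rewrite big_nil.
have := decomposableD k (sX i) (sY i) IH; congr decomposable.
by apply: mvP => x s; rewrite big_cons.
Qed.

(** In a frame [e_i] with dual coframe [d_i], [P] is half the sum over all ordered pairs of
    [P(d_i, d_j) e_i ∧ e_j]. Multiplying every [e_i] and [d_i] by a bump function [f] supported in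
    the frame domain makes all ingredients global. *)
Lemma locally_decomposable (R : realType) (n : nat) (M : manifold R n)
    (A : lie_algebroid M) (P : mvfield A) (x0 : M) : multivector 2 P ->
  exists2 g : Cinf M, g x0 <> 0 & decomposable (mv_wedge (mv_fun g) P).
Proof.
move=> [hP sP]; pose E := lbundle A; pose r := vrank E.
have [e fe ex0] := frames_cover E x0.
have [f [K [cK KU f0 fx0]]] := exists_bump (fdom_open e) ex0.
have [d dE] := exists_coframe e.
pose X (i : 'I_r) : forall x, A x := fun x => f x *: fvec e i x.
pose t (i : 'I_r) : oneform A := fun x => f x *: d i x.
have sX i : smooth_section (X i).
  move=> e' fe'; have [a [sa aE]] := frames_smooth fe' fe i.
  exists (fun j x => f x * a j x); split=> [j|x [_ e'x]].
    rewrite setTI.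
    exact: (smooth_on_mul_support (fdom_open e) (fdom_open e') cK KU
      f0 (Cinf_smooth f) (sa j)).
  rewrite /X; have [Kx|/f0 ->] := pselect (K x); last first.
    by rewrite scale0r big1// => j _; rewrite mul0r scale0r.
  rewrite aE; last by split => //; exact: KU.
  by rewrite scaler_sumr; apply: eq_bigr => j _; rewrite scalerA.
have st i : smooth_form (t i).
  move=> Y sY; have [a [sa aE]] := sY e fe.
  have := smooth_on_mul_support (fdom_open e) openT cK KU f0
    (Cinf_smooth f) (W := setT) (a := a i).
  rewrite setTI in sa; rewrite setIT => /(_ (sa i)); congr smooth_on.
  apply/funext => x; rewrite /t.
  transitivity (f x * d i x (Y x)) => //.
  have [Kx|/f0 ->] := pselect (K x); last by rewrite !mul0r.
  have ex := KU _ Kx; congr (_ * _).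
  apply: (@frame_coord_inj _ _ _ E e x (a^~ x) (fun j => d j x (Y x)) ex _ i).
  by rewrite -(dE x ex) aE.
pose Q (ij : 'I_r * 'I_r) : Cinf M := toCinf (fun x => P x [:: t ij.1 x; t ij.2 x]).
have QE ij x : Q ij x = P x [:: t ij.1 x; t ij.2 x].
  rewrite /Q toCinfE//; pose tt k := if k is 0%N then t ij.1 else t ij.2.
  by apply: (sP tt) => -[|k]; exact: st.
(* Two factors [f] come from the forms in [Q], two from the sections [X]. *)
exists (f * f * (f * f)).
  move=> /eqP; have : f x0 != 0 by exact/eqP.
  have -> : (f * f * (f * f)) x0 = f x0 * f x0 * (f x0 * f x0) by [].
  by rewrite !mulf_eq0 => /negPf ->.
have := decomposable_sum (L := A) (index_enum ('I_r * 'I_r)%type) (2^-1)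
  (fun ij => smooth_sectionZ (Cinf_smooth (Q ij)) (sX ij.1)) (fun ij => sX ij.2).
congr decomposable; apply: mvP => x s; rewrite mv_wedge_funE.
have -> : (f * f * (f * f)) x = f x * f x * (f x * f x) by [].
have [Kx|/f0 fx] := pselect (K x); last first.
  rewrite fx !mul0r big1// => ij _; rewrite /X fx !scale0r.
  case: s => [|a s]; first by rewrite /= mulr0 mulr0.
  by rewrite wedge_ext1; case: s => [|b [|c s]]; rewrite /= ?dual0; ring.
have ex := KU _ Kx; have [P0 Pl _] := hP x.
have [s2|s2] := eqVneq (size s) 2; last first.
  rewrite P0// mulr0 big1// => ij _.
  have [-> //] := homogeneous_wedge_ext1 (Q ij x *: X ij.1 x) (X ij.2 x).
  by rewrite mulr0.
case: s s2 => [//|a [//|b [|//]]] _.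
have PE : P x [:: a; b] = \sum_i \sum_j
    a (fvec e i x) * b (fvec e j x) * P x [:: d i x; d j x].
  rewrite {1}(coframe_dual a (dE x ex)) {1}(coframe_dual b (dE x ex)).
  rewrite (homogeneous_sum _ _ _ [::] _ (hP x)); apply: eq_bigr => i _ /=.
  rewrite (homogeneous_sum _ _ _ [:: d i x] [::] (hP x)) mulr_sumr.
  by apply: eq_bigr => j _; rewrite mulrA.
(* The same expansion with indices exchanged; its average with [PE] shows the determinants that are
   values of [e_i ∧ e_j]. *)
have PE' : P x [:: a; b] = - \sum_i \sum_j
    b (fvec e i x) * a (fvec e j x) * P x [:: d i x; d j x].
  rewrite PE exchange_big -sumrN; apply: eq_bigr => i _ /=.
  rewrite -sumrN; apply: eq_bigr => j _.
  by rewrite (homogeneous2_skew (d i x) (d j x) (hP x)); ring.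
have {}PE : P x [:: a; b] = \sum_i \sum_j 2^-1 * (P x [:: d i x; d j x] *
    (a (fvec e i x) * b (fvec e j x) - b (fvec e i x) * a (fvec e j x))).
  apply: (@mulfI _ (2 : R)); first by rewrite pnatr_eq0.
  rewrite mulr_natl mulr2n {1}PE PE' -sumrB mulr_sumr; apply: eq_bigr => i _.
  rewrite -sumrB mulr_sumr; apply: eq_bigr => j _.
  by rewrite mulrA divff ?pnatr_eq0// mul1r; ring.
rewrite PE pair_big mulr_sumr; apply: eq_bigr => -[i j] _.
rewrite wedge_ext1 /= QE /= /X !dualZ.
have -> : P x [:: t i x; t j x] = f x * f x * P x [:: d i x; d j x].
  have Pz (c : R) p q u : P x (p ++ c *: u :: q) = c * P x (p ++ u :: q).
    have := homogeneous_sum [:: tt] (fun=> c) (fun=> u) p q (hP x).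
    by rewrite !big_seq1.
  by rewrite (Pz _ [::] [:: _]) (Pz _ [:: _] [::]) mulrA.
ring.
Qed.

(** * Polarization and conclusion *)

Lemma schouten_jacobi_bivector (R : realType) (n : nat) (M : manifold R n)
    (A : jacobi_algebroid M) (S : schouten A) (P Q : mvfield A) :
  multivector 2 P -> multivector 2 Q ->
  schouten_jacobi S (phi0 A) 2 2 P Q = mv_zero -> forall x s,
  S P Q x s = - (wedge (mv_contract (phi0 A) Q x) (P x) s +
                 wedge (mv_contract (phi0 A) P x) (Q x) s).
Proof.
move=> mP mQ PQ x s; have := congr1 (fun T : mvfield A => T x s) PQ.
have [hQ _] := multivector_contract (@phi0_smooth _ _ _ A) mQ.
rewrite /schouten_jacobi /mv_add /mv_scale /mv_wedge.
rewrite (homogeneous2_wedgeC s (mP.1 x) (hQ x)) /mv_zero.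
rewrite (_ : 2%:R - 1 = 1 :> R); last by ring.
rewrite (_ : 2%:Z - 1 = 1)// expr1z mulr1 opprK !mul1r -addrA => /eqP.
by rewrite addr_eq0 => /eqP.
Qed.

Theorem theorem3 (R : realType) (n : nat) (M : manifold R n)
    (A : jacobi_algebroid M)
    (SA : schouten A) (SM : schouten (tangent_algebroid M))
    (P1 P2 : mvfield A) :
  compatible_jacobi_bivectors SA P1 P2 ->
  compatible_jacobi_structures SM
    (induced_bivector P1) (induced_vector_field P1)
    (induced_bivector P2) (induced_vector_field P2).
Proof.
move=> [[mP1 J11] [mP2 J22] J12].
have {}J11 := schouten_jacobi_bivector mP1 mP1 J11.
have {}J22 := schouten_jacobi_bivector mP2 mP2 J22.
have {}J12 := schouten_jacobi_bivector mP1 mP2 J12.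
(* The induced vector field, defined through [sharp], is the push-forward of the contraction by
   [phi0]. *)
have EP P : multivector 2 P ->
    @mv_sec R n M (tangent_algebroid M) (induced_vector_field P) =
    pushforward (mv_contract (phi0 A) P).
  move=> [hP _]; rewrite -pushforward_sec; congr pushforward.
  by apply: mvP => x s; rewrite /mv_contract (contract_sharp _ (hP x)).
split.
- apply: (jacobi_structure_pushforward (SA := SA) SM mP1 _ _ (EP _ mP1)).
    by apply: mvP => x s; rewrite J11 /mv_scale /mv_wedge; ring.
  by move=> x; exact: locally_decomposable.
- apply: (jacobi_structure_pushforward (SA := SA) SM mP2 _ _ (EP _ mP2)).
    by apply: mvP => x s; rewrite J22 /mv_scale /mv_wedge; ring.
  by move=> x; exact: locally_decomposable.
have addE (L : algebroid_data M) (P Q : mvfield L) :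
    mv_add P Q = mv_add (mv_scale 1 P) Q.
  by apply: mvP => x s; rewrite /mv_add /mv_scale mul1r.
have mP : multivector 2 (mv_add P1 P2) by rewrite addE; exact: multivector_lin.
(* The sum of the two induced bivectors is, by computation, the push-forward of [P1 + P2]. *)
apply: (jacobi_structure_pushforward (SA := SA) SM mP).
- rewrite {1 2}addE (sb_linear SA 1 (multivector_lin 1 mP1 mP2) mP1 mP2).
  rewrite (sb_linear_l SA 1 mP1 mP2 mP1) (sb_linear_l SA 1 mP1 mP2 mP2).
  apply: mvP => x s.
  (* [[P2, P1] = [P1, P2]], so the mixed terms of the expanded square are twice the bracket
     controlled by [J12]. *)
  have := sb_skew2 SA mP1 mP2 s; rewrite sqrrN expr1n mul1r => E21.
  have linE (P Q : mvfield A) t : mv_add (mv_scale 1 P) Q x t = 1 * P x t + Q x t.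
    by [].
  rewrite !linE E21 J11 J22 J12 /mv_scale /mv_wedge addE.
  have -> : mv_contract (phi0 A) (mv_add (mv_scale 1 P1) P2) x =
    (fun t => 1 * mv_contract (phi0 A) P1 x t + mv_contract (phi0 A) P2 x t) by [].
  have -> : mv_add (mv_scale 1 P1) P2 x = (fun t => 1 * P1 x t + P2 x t) by [].
  by rewrite wedge_linl !wedge_linr; ring.
- by move=> x; exact: locally_decomposable.
- apply: mvP => x s; have := EP _ mP1; have := EP _ mP2.
  move=> /(congr1 (fun T : mvfield (tangent_algebroid M) => T x s)) E2.
  move=> /(congr1 (fun T : mvfield (tangent_algebroid M) => T x s)) E1.
  transitivity (pushforward (mv_contract (phi0 A) P1) x s +
    pushforward (mv_contract (phi0 A) P2) x s) => //.
  rewrite -E1 -E2 /mv_sec; case: s {E1 E2} => [|a [|b s]] /=; rewrite ?addr0//.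
  exact: dualD.
Qed.
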